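(* Let $m\ge 1$ be an integer, $n=2m+1$, $z\in\mathbb Z\setminus n\mathbb Z$, $\nu=z/n$ (so $\mu=n\nu=z$), and $\mathcal H=H_{1,\nu}(I_2(n))$. Let $tr_z$ be the trace on $\mathcal H$ determined by $$tr_z(S_k)=\frac{\tau}{n\sin^2\frac{\pi k}{n}}\Bigl(1-\cos\frac{2\pi kz}{n}\Bigr),\qquad k=1,\dots,m,$$ and let $str_z$ be the supertrace on $\mathcal H$ determined by $$str_z(S_k)=\frac{\tau'}{n\cos^2\frac{\pi k}{n}}\Bigl(1-(-1)^z\cos\frac{2\pi kz}{n}\Bigr),\qquad k=0,\dots,m,$$ where $\tau,\tau'\in\mathbb C\setminus\{0\}$ are arbitrary. Let $$\mathcal I^{+1}=\{x\in\mathcal H: tr_z(xy)=0\ \text{for all } y\in\mathcal H\},\qquad \mathcal I^{-1}=\{x\in\mathcal H: str_z(xy)=0\ \text{for all } y\in\mathcal H\}.$$ Then $\mathcal I^{+1}=\mathcal I^{-1}$.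
   Context: Let $n=2m+1$ and $\lambda=\exp(2\pi i/n)$. The group $I_2(n)$ is the symmetry group of the regular flat $n$-gon (dihedral group of order $2n$); it consists of $n$ reflections $R_k$ and $n$ rotations $S_k$, with indices $k$ taken modulo $n$, satisfying $R_kR_l=S_{k-l}$, $S_kS_l=S_{k+l}$, $R_kS_l=R_{k-l}$, $S_kR_l=R_{k+l}$; $S_0$ is the unit. In the group algebra $\mathbb C[I_2(n)]$ put $$L_p=\frac1n\sum_{k=0}^{n-1}\lambda^{kp}R_k,\qquad Q_p=\frac1n\sum_{k=0}^{n-1}\lambda^{-kp}S_k\qquad(p\in\mathbb Z/n).$$ The symplectic reflection algebra $\mathcal H=H_{1,\nu}(I_2(n))$, $\nu\in\mathbb C$, is the associative unital $\mathbb C$-algebra generated by $\mathbb C[I_2(n)]$ (its unit $S_0$ being the unit of $\mathcal H$) and elements $a^\alpha,b^\alpha$, $\alpha\in\{0,1\}$, with the relations of $\mathbb C[I_2(n)]$ and, with $\mu:=n\nu$, $$L_pa^\alpha=-b^\alpha L_{p+1},\quad L_pb^\alpha=-a^\alpha L_{p-1},\quad Q_pa^\alpha=a^\alpha Q_{p+1},\quad Q_pb^\alpha=b^\alpha Q_{p-1},$$ $$[a^\alpha,b^\beta]=\varepsilon^{\alpha\beta}(1+\mu L_0),\quad [a^\alpha,a^\beta]=\varepsilon^{\alpha\beta}\mu L_1,\quad [b^\alpha,b^\beta]=\varepsilon^{\alpha\beta}\mu L_{-1},$$ where $\varepsilon^{\alpha\beta}$ is skew-symmetric with $\varepsilon^{01}=1$.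 $\mathcal H$ is $\mathbb Z_2$-graded by the parity $\varepsilon(a^\alpha)=\varepsilon(b^\alpha)=1$, $\varepsilon(R_k)=\varepsilon(S_k)=0$. A trace on $\mathcal H$ is a linear function $tr:\mathcal H\to\mathbb C$ with $tr(fg-gf)=0$ for all $f,g$. A supertrace is a linear function $str:\mathcal H\to\mathbb C$ with $str(fg-(-1)^{\varepsilon(f)\varepsilon(g)}gf)=0$ for all homogeneous $f,g$. Known background: a trace on $\mathcal H$ is uniquely determined by its values $tr(S_k)=tr(S_{n-k})$, $k=1,\dots,m$, and these values can be chosen arbitrarily; a supertrace on $\mathcal H$ is uniquely determined by its values $str(S_k)=str(S_{n-k})$, $k=0,\dots,m$ (indices modulo $n$), and these values can be chosen arbitrarily. *)

(* Defs.v *)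
From HB Require Import structures.
From mathcomp Require Import all_boot all_order all_algebra.
From mathcomp Require Import generic_quotient complex.
From mathcomp Require Import all_classical all_reals all_analysis.
From mathcomp Require monalg.
(* The notations of monalg clash with those of mathcomp-analysis. *)
Import -(notations) monalg.

Set Implicit Arguments.
Unset Strict Implicit.
Unset Printing Implicit Defensive.

Import Order.TTheory GRing.Theory Num.Theory.
Local Open Scope ring_scope.
Local Open Scope complex_scope.
Local Open Scope quotient_scope.

(* The free unital K-algebra on the alphabet I is the monoid algebra
   [malg (fmonom I) K] of the free monoid on I. *)
Section FreeAlgebra.
Context (K : comNzRingType) (I : choiceType).
Implicit Types (c : K) (x y : malg (fmonom I) K).

Fact malg_scalerAr c x y : c *: (x * y) = x * (c *: y).
Proof.
have commC : mkmalgU mone c * x = x * mkmalgU mone c.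
  rewrite !malgM_def fgmulUg fgmulgU; apply: eq_bigr => k _.
  by rewrite mul1m mulm1 mulrC.
by rewrite -!mul_malgC mulrA commC mulrA.
Qed.

Definition letter (i : I) : malg (fmonom I) K := mkmalgU (fmu i) 1.
End FreeAlgebra.

(* The quotient of an algebra by the two-sided ideal generated by the
   differences l - r, for all pairs (l, r) with rel l r. *)
Section PresentedAlgebra.
Context (K : comNzRingType) (A : lalgType K) (rel : A -> A -> Prop).
Implicit Types (x y u v : A) (c : K).

Inductive rel_ideal : A -> Prop :=
| rel_ideal0 : rel_ideal 0
| rel_idealD x y : rel_ideal x -> rel_ideal y -> rel_ideal (x + y)
| rel_idealM u v l r : rel l r -> rel_ideal (u * (l - r) * v).

Lemma rel_idealMl u x : rel_ideal x -> rel_ideal (u * x).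
Proof.
elim=> [|y z _ hy _ hz|u' v l r h].
- by rewrite mulr0; exact: rel_ideal0.
- by rewrite mulrDr; exact: rel_idealD.
- by rewrite 2!mulrA; exact: rel_idealM.
Qed.

Lemma rel_idealMr v x : rel_ideal x -> rel_ideal (x * v).
Proof.
elim=> [|y z _ hy _ hz|u v' l r h].
- by rewrite mul0r; exact: rel_ideal0.
- by rewrite mulrDl; exact: rel_idealD.
- by rewrite -mulrA; exact: rel_idealM.
Qed.

Lemma rel_idealZ c x : rel_ideal x -> rel_ideal (c *: x).
Proof. by move=> hx; rewrite -(mul1r x) scalerAl; exact: rel_idealMl. Qed.

Lemma rel_idealN x : rel_ideal x -> rel_ideal (- x).
Proof. by rewrite -scaleN1r; exact: rel_idealZ. Qed.

Definition rel_equiv x y : bool := `[< rel_ideal (x - y) >].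

Lemma rel_equiv_refl : reflexive rel_equiv.
Proof. by move=> x; apply/asboolP; rewrite subrr; exact: rel_ideal0. Qed.

Lemma rel_equiv_sym : symmetric rel_equiv.
Proof.
move=> x y; apply/asboolP/asboolP => /rel_idealN; by rewrite opprB.
Qed.

Lemma rel_equiv_trans : transitive rel_equiv.
Proof.
move=> y x z /asboolP hxy /asboolP hyz; apply/asboolP.
by rewrite -(subrKA y); exact: rel_idealD.
Qed.

Canonical rel_equivRel :=
  EquivRel rel_equiv rel_equiv_refl rel_equiv_sym rel_equiv_trans.

Definition presented_algebra : Type := {eq_quot rel_equivRel}.
HB.instance Definition _ := Choice.on presented_algebra.
HB.instance Definition _ :=
  EqQuotient.on presented_algebra.

Local Notation Q := presented_algebra.

Lemma presentedP x y : reflect (rel_ideal (x - y)) (\pi_Q x == \pi_Q y).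
Proof. by rewrite eqquotE; exact: asboolP. Qed.

Let repr_pi x : rel_ideal (repr (\pi_Q x) - x).
Proof. by apply/presentedP; rewrite reprK. Qed.

Let piP (a : Q) : {x | a = \pi_Q x}.
Proof. by exists (repr a); rewrite reprK. Qed.

Definition presented_add (a b : Q) : Q := \pi_Q (repr a + repr b).
Definition presented_opp (a : Q) : Q := \pi_Q (- repr a).
Definition presented_mul (a b : Q) : Q := \pi_Q (repr a * repr b).
Definition presented_scale c (a : Q) : Q := \pi_Q (c *: repr a).

Let addE x y : presented_add (\pi_Q x) (\pi_Q y) = \pi_Q (x + y).
Proof. by apply/eqP/presentedP; rewrite opprD addrACA; exact: rel_idealD. Qed.

Let oppE x : presented_opp (\pi_Q x) = \pi_Q (- x).
Proof. by apply/eqP/presentedP; rewrite -opprD; exact: rel_idealN. Qed.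

Let mulE x y : presented_mul (\pi_Q x) (\pi_Q y) = \pi_Q (x * y).
Proof.
apply/eqP/presentedP; rewrite -(subrKA (repr (\pi_Q x) * y)) -mulrBr -mulrBl.
by apply: rel_idealD; [exact: rel_idealMl | exact: rel_idealMr].
Qed.

Let scaleE c x : presented_scale c (\pi_Q x) = \pi_Q (c *: x).
Proof. by apply/eqP/presentedP; rewrite -scalerBr; exact: rel_idealZ. Qed.

Let addA : associative presented_add.
Proof.
move=> a b c; have [x ->] := piP a; have [y ->] := piP b.
by have [z ->] := piP c; rewrite !addE addrA.
Qed.
Let addC : commutative presented_add.
Proof.
by move=> a b; have [x ->] := piP a; have [y ->] := piP b; rewrite !addE addrC.
Qed.
Let add0 : left_id (\pi_Q 0) presented_add.
Proof. by move=> a; have [x ->] := piP a; rewrite addE add0r. Qed.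
Let addN : left_inverse (\pi_Q 0) presented_opp presented_add.
Proof. by move=> a; have [x ->] := piP a; rewrite oppE addE addNr. Qed.
HB.instance Definition _ := GRing.isZmodule.Build Q addA addC add0 addN.

Let mulA : associative presented_mul.
Proof.
move=> a b c; have [x ->] := piP a; have [y ->] := piP b.
by have [z ->] := piP c; rewrite !mulE mulrA.
Qed.
Let mul1 : left_id (\pi_Q 1) presented_mul.
Proof. by move=> a; have [x ->] := piP a; rewrite mulE mul1r. Qed.
Let mulx1 : right_id (\pi_Q 1) presented_mul.
Proof. by move=> a; have [x ->] := piP a; rewrite mulE mulr1. Qed.
Let mulDl : left_distributive presented_mul presented_add.
Proof.
move=> a b c; have [x ->] := piP a; have [y ->] := piP b.
by have [z ->] := piP c; rewrite !(addE, mulE) mulrDl.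
Qed.
Let mulDr : right_distributive presented_mul presented_add.
Proof.
move=> a b c; have [x ->] := piP a; have [y ->] := piP b.
by have [z ->] := piP c; rewrite !(addE, mulE) mulrDr.
Qed.
(* The presentation alone does not say that 1 != 0, which [lalgType]
   requires; Q is a ring and a module, related by [presented_scalerAl]. *)
HB.instance Definition _ :=
  GRing.Zmodule_isPzRing.Build Q mulA mul1 mulx1 mulDl mulDr.

Let scaleA c d (a : Q) :
  presented_scale c (presented_scale d a) = presented_scale (c * d) a.
Proof. by have [x ->] := piP a; rewrite !scaleE scalerA. Qed.
Let scale1 : left_id 1 presented_scale.
Proof. by move=> a; have [x ->] := piP a; rewrite scaleE scale1r. Qed.
Let scaleDr : right_distributive presented_scale presented_add.
Proof.
move=> c a b; have [x ->] := piP a.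
by have [y ->] := piP b; rewrite !(addE, scaleE) scalerDr.
Qed.
Let scaleDl (a : Q) :
  {morph presented_scale^~ a : c d / c + d >-> presented_add c d}.
Proof.
by move=> c d; have [x ->] := piP a; rewrite !(addE, scaleE) scalerDl.
Qed.
HB.instance Definition _ :=
  GRing.Zmodule_isLmodule.Build K Q scaleA scale1 scaleDr scaleDl.

Definition presented_pi : A -> Q := \pi_Q.

Lemma presented_pi_is_zmod_morphism : zmod_morphism presented_pi.
Proof. by move=> x y; rewrite /presented_pi -addE -oppE. Qed.
HB.instance Definition _ :=
  GRing.isZmodMorphism.Build A Q presented_pi presented_pi_is_zmod_morphism.
Lemma presented_pi_is_monoid_morphism : monoid_morphism presented_pi.
Proof. by split=> [//|x y]; rewrite /presented_pi -mulE. Qed.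
HB.instance Definition _ :=
  GRing.isMonoidMorphism.Build A Q presented_pi presented_pi_is_monoid_morphism.
Lemma presented_pi_is_scalable : scalable presented_pi.
Proof. by move=> c x; rewrite /presented_pi -scaleE. Qed.
HB.instance Definition _ :=
  GRing.isScalable.Build K A Q *:%R presented_pi presented_pi_is_scalable.

Lemma presented_rel l r : rel l r -> presented_pi l = presented_pi r.
Proof.
move=> h; apply/eqP/presentedP.
by rewrite -(mulr1 (l - r)) -(mul1r (l - r)); exact: rel_idealM.
Qed.

Lemma presented_pi_surj (a : Q) : exists x, presented_pi x = a.
Proof. by exists (repr a); exact: reprK. Qed.

Lemma presented_scalerAl c (a b : Q) : c *: (a * b) = (c *: a) * b.
Proof.
have [[x <-] [y <-]] := (presented_pi_surj a, presented_pi_surj b).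
by rewrite -rmorphM -!linearZ -rmorphM /= scalerAl.
Qed.

End PresentedAlgebra.

Section Generators.
Context (n : nat).

Inductive generator : predArgType :=
| genR of 'I_n | genS of 'I_n | gena of 'I_2 | genb of 'I_2.

Definition generator_code (g : generator) : 'I_n + 'I_n + ('I_2 + 'I_2) :=
  match g with
  | genR k => inl (inl k) | genS k => inl (inr k)
  | gena i => inr (inl i) | genb i => inr (inr i)
  end.

Definition generator_decode (s : 'I_n + 'I_n + ('I_2 + 'I_2)) : generator :=
  match s with
  | inl (inl k) => genR k | inl (inr k) => genS k
  | inr (inl i) => gena i | inr (inr i) => genb i
  end.

Lemma generator_codeK : cancel generator_code generator_decode.
Proof. by case. Qed.

HB.instance Definition _ := Choice.copy generator (can_type generator_codeK).

Definition odd_generator (g : generator) : bool :=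
  match g with genR _ | genS _ => false | gena _ | genb _ => true end.
End Generators.

Section SymplecticReflectionAlgebra.
Context (R : realType) (m : nat).

Local Notation C := R[i].
Local Notation n := m.*2.+1.

Definition sra_free : lalgType C := malg (fmonom (generator n)) C.

Definition lambda : C := cos (2 * pi / n%:R) +i* sin (2 * pi / n%:R).

(* The indices k modulo n live in the additive group 'I_n = Z/n, in which
   k + l and k - l are computed modulo n.  The index p of L_p and Q_p is an
   integer: lambda ^ (k * p) depends on p modulo n only. *)
Definition fR (k : 'I_n) : sra_free := letter C (genR k).
Definition fS (k : 'I_n) : sra_free := letter C (genS k).
Definition fa (i : 'I_2) : sra_free := letter C (gena n i).
Definition fb (i : 'I_2) : sra_free := letter C (genb n i).

Definition fL (p : int) : sra_free :=
  n%:R^-1 *: \sum_(k < n) lambda ^ (k%:Z * p) *: fR k.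
Definition fQ (p : int) : sra_free :=
  n%:R^-1 *: \sum_(k < n) lambda ^ (- (k%:Z * p)) *: fS k.

Definition eps (i j : 'I_2) : C := (j%:Z - i%:Z)%:~R.

Definition commutator (A : pzRingType) (x y : A) : A := x * y - y * x.

Context (nu : C).
Local Notation mu := (n%:R * nu).

Inductive sra_rel : sra_free -> sra_free -> Prop :=
| sra_S0 : sra_rel (fS 0) 1
| sra_RR k l : sra_rel (fR k * fR l) (fS (k - l))
| sra_SS k l : sra_rel (fS k * fS l) (fS (k + l))
| sra_RS k l : sra_rel (fR k * fS l) (fR (k - l))
| sra_SR k l : sra_rel (fS k * fR l) (fR (k + l))
| sra_La p i : sra_rel (fL p * fa i) (- (fb i * fL (p + 1)))
| sra_Lb p i : sra_rel (fL p * fb i) (- (fa i * fL (p - 1)))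
| sra_Qa p i : sra_rel (fQ p * fa i) (fa i * fQ (p + 1))
| sra_Qb p i : sra_rel (fQ p * fb i) (fb i * fQ (p - 1))
| sra_ab i j : sra_rel (commutator (fa i) (fb j)) (eps i j *: (1 + mu *: fL 0))
| sra_aa i j : sra_rel (commutator (fa i) (fa j)) (eps i j *: (mu *: fL 1))
| sra_bb i j : sra_rel (commutator (fb i) (fb j)) (eps i j *: (mu *: fL (- 1))).

(* H_{1,nu}(I_2(n)) *)
Definition sra : Type := presented_algebra sra_rel.
HB.instance Definition _ := GRing.PzRing.on sra.
HB.instance Definition _ := GRing.Lmodule.on sra.

Definition sra_pi : sra_free -> sra := @presented_pi _ _ sra_rel.
HB.instance Definition _ := GRing.RMorphism.on sra_pi.
HB.instance Definition _ := GRing.Linear.on sra_pi.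

Lemma sra_scalerAl (c : C) (x y : sra) : c *: (x * y) = (c *: x) * y.
Proof. exact: presented_scalerAl. Qed.

Lemma sra_scalerAr (c : C) (x y : sra) : c *: (x * y) = x * (c *: y).
Proof.
have [[f <-] [g <-]] : (exists f, sra_pi f = x) * (exists g, sra_pi g = y).
  by split; exact: presented_pi_surj.
by rewrite -rmorphM -!linearZ -rmorphM; congr sra_pi; exact: malg_scalerAr.
Qed.

Definition sraR (k : 'I_n) : sra := sra_pi (fR k).
Definition sraS (k : 'I_n) : sra := sra_pi (fS k).
Definition sraa (i : 'I_2) : sra := sra_pi (fa i).
Definition srab (i : 'I_2) : sra := sra_pi (fb i).

(* x is a linear combination of words in which the number of letters a, b has
   parity e. *)
Definition homogeneous (e : bool) (x : sra) : Prop :=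
  exists2 f : sra_free,
    (forall w : fmonom (generator n),
       mcoeff w f != 0 -> odd (count (@odd_generator n) w) = e)
    & sra_pi f = x.

Definition is_trace (t : {scalar sra}) : Prop :=
  forall f g : sra, t (f * g - g * f) = 0.

Definition is_supertrace (t : {scalar sra}) : Prop :=
  forall (e e' : bool) (f g : sra), homogeneous e f -> homogeneous e' g ->
    t (f * g - (-1) ^+ (e * e') *: (g * f)) = 0.

Definition null_ideal (t : {scalar sra}) : set sra :=
  [set x | forall y : sra, t (x * y) = 0]%classic.

End SymplecticReflectionAlgebra.

(* Main.v *)
(* Put [r = |z|].  For [mu = z] the algebra acts on the functions of a level [i]
   and a character label [p] with [0 <= i] and [i + |p| < r], a space of
   dimension [r^2] on which [S_k] multiplies by [lambda^(k p)].  By the Fejer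
   kernel, the trace of [S_k] in this representation [rho] is
   [sin^2 (pi k z / n) / sin^2 (pi k / n)], and inserting the parity operator
   [K = (-1)^p] gives the analogous values with [cos^2 (pi k / n)].  Since a
   (super)trace is determined by its values on the [S_k], [tr_z] is a nonzero
   multiple of [Tr (rho x)] and [str_z] one of [Tr (K * rho x)].  The element of
   [H] that spans the Cartan part of the inner sl_2 acts on the function at
   [(i, p)] by the integer [2 i + |p| - (r - 1)], so [K] is a polynomial in its
   image and hence [K = rho u] for some [u].  Multiplying [y] by [u] and using
   [K^2 = 1] exchanges the two conditions [Tr (rho (x y)) = 0] and
   [Tr (K rho (x y)) = 0]. *)
Require Import Defs.
From HB Require Import structures.
From mathcomp Require Import all_boot all_order all_algebra.
From mathcomp Require Import complex.
From mathcomp Require Import all_classical all_reals all_analysis.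
From mathcomp Require monalg.
Import -(notations) monalg.
From mathcomp Require Import zify ring lra.

Set Implicit Arguments.
Unset Strict Implicit.
Unset Printing Implicit Defensive.

Import Order.TTheory GRing.Theory Num.Theory.
Local Open Scope ring_scope.
Local Open Scope complex_scope.

(** * Roots of unity and the Fejer kernel *)

(** The longest ingredient is the uniqueness of (super)traces. A functional that vanishes on the
    relevant [S_k] is shown to vanish on every product of letters and a group element, by induction
    on the number of letters. A commutator of letters removes two of them but creates reflections,
    so each group element needs its own way of cycling a letter around. Past a rotation the letter
    returns with a factor other than 1, which kills the value. A reflection, and for traces the
    unit, only offers a letter that returns unchanged; then its symplectic partner is brought in.
    Both signs of [z] are treated at once: replacing [R_k] by [- R_k] respects the group relations
    and changes [nu] into [- nu], which the sign [theta] records. For fixed [p] there are [r - |p|]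
    levels, and this is the coefficient of [x^p] in the Fejer kernel. Oddness of [n] enters because
    -1 is then no power of [lambda]; that [n] does not divide [z] enters because the operators have
    denominators [r - |p|] with [n] dividing [p]. *)

Section RootOfUnity.
Context (R : realType) (m : nat).
Local Notation C := R[i].
Local Notation n := m.*2.+1.
Local Notation w := (lambda R m).

Lemma lambda_expE k :
  w ^+ k = cos (2 * pi * k%:R / n%:R) +i* sin (2 * pi * k%:R / n%:R).
Proof.
elim: k => [|k IHk]; first by rewrite expr0 mulr0 mul0r cos0 sin0.
rewrite exprSr IHk /lambda.
have -> : 2 * pi * k.+1%:R / n%:R = 2 * pi * k%:R / n%:R + 2 * pi / n%:R :> R.
  by rewrite -addn1 natrD; ring.
rewrite sinD cosD -[LHS]/(_ +i* _).
by congr (_ +i* _); rewrite addrC [_ * sin _]mulrC [sin _ * cos _]mulrC.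
Qed.

Lemma lambda_expn : w ^+ n = 1.
Proof.
rewrite lambda_expE mulfK ?pnatr_eq0//.
by rewrite mulrC mulr_natr cos2pi sin2pi.
Qed.

Lemma lambda_neq0 : w != 0.
Proof.
apply/eqP => w0; move: lambda_expn; rewrite w0 expr0n /= => /eqP.
by rewrite eq_sym oner_eq0.
Qed.

Lemma lambda_expz_mod (j : int) : w ^ (j %% n)%Z = w ^ j.
Proof.
rewrite [in RHS](divz_eq j n) [(j %/ n)%Z * _]mulrC [RHS]expfzDr ?lambda_neq0//.
by rewrite -[w ^ (n%:Z * _)]exprz_exp -exprnP lambda_expn exp1rz mul1r.
Qed.

Lemma lambda_expz_eq1 (j : int) : (w ^ j == 1) = (n %| j)%Z.
Proof.
apply/idP/idP => [/eqP wj|/dvdz_mod0P jn]; last first.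
  by rewrite -lambda_expz_mod jn expr0z.
apply/dvdz_mod0P; move: wj; rewrite -lambda_expz_mod.
have := ltz_pmod j (isT : (0 < n%:Z)); have := modz_ge0 j (isT : n%:Z != 0).
case: (j %% n)%Z => // k _ kn; rewrite -exprnP lambda_expE => -[cosE _].
case: k kn cosE => // k kn cosE; exfalso.
(* Half of the angle lies strictly between 0 and pi, so its sine is nonzero; cosine 1 of the full
   angle would make it vanish. *)
set x := pi * k.+1%:R / n%:R : R.
have n0 : (0 : R) < n%:R by rewrite ltr0n.
have /sin_gt0_pi : 0 < x < pi.
  rewrite /x ltr_pdivrMr// ltr_pM2l ?pi_gt0// ltr_nat -ltz_nat kn andbT.
  by rewrite divr_gt0// mulr_gt0 ?pi_gt0// ltr0n.
suff : sin x ^+ 2 = 0 by move/eqP; rewrite sqrf_eq0 => /eqP ->; rewrite ltxx.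
move: cosE; have -> : 2 * pi * k.+1%:R / n%:R = x *+ 2 by rewrite /x; ring.
by rewrite cos_mulr2n sin2cos2; lra.
Qed.

Lemma sum_lambda (j : int) :
  \sum_(k < n) w ^ (k%:Z * j) = if (n %| j)%Z then n%:R else 0 :> C.
Proof.
have E (k : 'I_n) : w ^ (k%:Z * j) = (w ^ j) ^+ k by rewrite mulrC -exprz_exp.
under eq_bigr do rewrite E; case: ifPn => [|nj].
  rewrite -lambda_expz_eq1 => /eqP ->.
  by under eq_bigr do rewrite expr1n; rewrite sumr_const card_ord.
have : (w ^ j - 1) * \sum_(k < n) (w ^ j) ^+ k = 0.
  by rewrite -subrX1 exprnP exprzAC -exprnP lambda_expn exp1rz subrr.
by move/eqP; rewrite mulf_eq0 subr_eq0 lambda_expz_eq1 (negPf nj) => /eqP.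
Qed.

Lemma lambda_expz_modn (k l : nat) (j : int) :
  w ^ ((k %% n)%N%:Z * j) = w ^ (k%:Z * j).
Proof. by rewrite -!exprz_exp -modz_nat lambda_expz_mod. Qed.

Lemma lambda_expz_addI (k l : 'I_n) (j : int) :
  w ^ ((k + l)%R%:Z * j) = w ^ (k%:Z * j) * w ^ (l%:Z * j).
Proof.
rewrite lambda_expz_modn; last exact: 0%N.
by rewrite -expfzDr ?lambda_neq0// -mulrDl PoszD.
Qed.

Lemma lambda_expz_oppI (k : 'I_n) (j : int) :
  w ^ ((- k)%R%:Z * j) = w ^ (- (k%:Z * j)).
Proof.
have : w ^ ((- k)%R%:Z * j) * w ^ (k%:Z * j) = 1.
  by rewrite -lambda_expz_addI addNr mul0r expr0z.
move=> H; rewrite -[LHS]mulr1 -(expr0z w) -(subrr (k%:Z * j)).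
by rewrite expfzDr ?lambda_neq0// mulrA H mul1r.
Qed.

(** Oddness of [n] is decisive: [lambda ^ (2 j) = 1] gives [n %| 2 j], hence [n %| j]. It is also
    the reason why [cos (pi k / n)] never vanishes. *)
Lemma lambda_expz_neqN1 (j : int) : w ^ j != -1.
Proof.
apply/negP => /eqP wj; have : (n %| j)%Z.
  have : (n %| j * 2)%Z.
    by rewrite -lambda_expz_eq1 -exprz_exp wj -exprnP sqrrN expr1n.
  by rewrite Gauss_dvdzl// coprimezE /= coprimen2 /= odd_double.
rewrite -lambda_expz_eq1 wj eq_sym -subr_eq0 opprK.
by rewrite -[_ == _]/(2%:R == 0) pnatr_eq0.
Qed.

Lemma lambda_expzD_cos (k : nat) (j : int) :
  w ^ (k%:Z * j) + w ^ (- (k%:Z * j)) =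
    2 * (cos (2 * pi * k%:R * j%:~R / n%:R))%:C.
Proof.
wlog [l ->] : j / exists l : nat, j = l.
  case: j => l IH; first by apply: IH; exists l.
  rewrite NegzE mulrN opprK addrC IH; last by exists l.+1.
  by rewrite -NegzE NegzE mulrNz mulrN mulNr cosN.
set x := 2 * pi * k%:R * l%:~R / n%:R : R.
have wx : w ^+ (k * l) = cos x +i* sin x.
  rewrite lambda_expE; suff -> : 2 * pi * (k * l)%:R / n%:R = x by [].
  by rewrite natrM /x mulrA.
rewrite -PoszM -exprnN wx -exprnP wx.
have -> : (cos x +i* sin x)^-1 = cos x +i* - sin x.
  apply: mulr1_eq; rewrite -[LHS]/(_ +i* _) mulrN opprK -!expr2 cos2Dsin2.
  by rewrite mulrN [sin x * _]mulrC addNr.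
by rewrite -[LHS]/(_ +i* _) -[RHS]/(_ +i* _); congr (_ +i* _); ring.
Qed.

(* The Fejer kernel, with denominators cleared. *)
Lemma fejer (x : C) (r : nat) : x != 0 ->
  (2 - x - x^-1) * \sum_(i < r) \sum_(j < r) x ^ (i%:Z - j%:Z) =
    2 - x ^+ r - x ^- r.
Proof.
move=> x0.
have -> : \sum_(i < r) \sum_(j < r) x ^ (i%:Z - j%:Z) =
    (\sum_(i < r) x ^+ i) * \sum_(j < r) x^-1 ^+ j.
  rewrite big_distrlr; apply: eq_bigr => i _; apply: eq_bigr => j _.
  by rewrite expfzDr// exprVn exprnN.
have -> : 2 - x - x^-1 = (x - 1) * (x^-1 - 1).
  by rewrite mulrBr mulrBl mulfV// mul1r; ring.
rewrite mulrACA -!subrX1 mulrBl mulrBr exprVn mulfV ?expf_neq0//.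
by ring.
Qed.

End RootOfUnity.

(** * Relations in the symplectic reflection algebra *)

Section Relations.
Context (R : realType) (m : nat) (nu : R[i]).
Local Notation C := R[i].
Local Notation n := m.*2.+1.
Local Notation w := (lambda R m).
Local Notation mu := (n%:R * nu).
Local Notation H := (sra m nu).
Local Notation a := (sraa m nu).
Local Notation b := (srab m nu).

Definition sraL (p : int) : H :=
  n%:R^-1 *: \sum_(k < n) w ^ (k%:Z * p) *: sraR nu k.

Definition sra_generator (g : generator n) : H :=
  match g with
  | genR k => sraR nu k | genS k => sraS nu k
  | gena i => a i | genb i => b i
  end.

Lemma sra_pi_rel (l r : sra_free R m) : sra_rel nu l r -> sra_pi nu l = sra_pi nu r.
Proof. exact: presented_rel. Qed.

Lemma sra_piZ c (x : sra_free R m) : sra_pi nu (c *: x) = c *: sra_pi nu x.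
Proof. exact: presented_pi_is_scalable. Qed.

Lemma sra_piB (x y : sra_free R m) :
  sra_pi nu (x - y) = sra_pi nu x - sra_pi nu y.
Proof. exact: presented_pi_is_zmod_morphism. Qed.

Lemma sra_pi0 : sra_pi nu (0 : sra_free R m) = 0.
Proof. by rewrite -[0 in LHS](subrr 0) sra_piB subrr. Qed.

Lemma sra_piN (x : sra_free R m) : sra_pi nu (- x) = - sra_pi nu x.
Proof. by rewrite -sub0r sra_piB sra_pi0 sub0r. Qed.

Lemma sra_piD (x y : sra_free R m) :
  sra_pi nu (x + y) = sra_pi nu x + sra_pi nu y.
Proof. by rewrite -[y in LHS]opprK sra_piB sra_piN opprK. Qed.

Lemma sra_pi1 : sra_pi nu (1 : sra_free R m) = 1.
Proof. by []. Qed.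

Lemma sra_piM (x y : sra_free R m) :
  sra_pi nu (x * y) = sra_pi nu x * sra_pi nu y.
Proof. exact: (presented_pi_is_monoid_morphism _).2. Qed.

Lemma sra_pi_sum (I : Type) (r : seq I) (F : I -> sra_free R m) :
  sra_pi nu (\sum_(i <- r) F i) = \sum_(i <- r) sra_pi nu (F i).
Proof. exact: (big_morph _ sra_piD sra_pi0). Qed.

Lemma sra_pi_fL p : sra_pi nu (fL R m p) = sraL p.
Proof.
rewrite /fL sra_piZ sra_pi_sum; apply: f_equal; apply: eq_bigr => k _.
by rewrite sra_piZ.
Qed.

Lemma sra_pi_fQ p : sra_pi nu (fQ R m p) =
  n%:R^-1 *: \sum_(k < n) w ^ (- (k%:Z * p)) *: sraS nu k.
Proof.
rewrite /fQ sra_piZ sra_pi_sum; apply: f_equal; apply: eq_bigr => k _.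
by rewrite sra_piZ.
Qed.

Lemma sraS0 : sraS nu (0 : 'I_n) = 1.
Proof. by rewrite /sraS (sra_pi_rel (sra_S0 _ _)) sra_pi1. Qed.

Lemma sraRR (k l : 'I_n) : sraR nu k * sraR nu l = sraS nu (k - l).
Proof. by rewrite -sra_piM; exact/sra_pi_rel/sra_RR. Qed.

Lemma sraSS (k l : 'I_n) : sraS nu k * sraS nu l = sraS nu (k + l).
Proof. by rewrite -sra_piM; exact/sra_pi_rel/sra_SS. Qed.

Lemma sraRS (k l : 'I_n) : sraR nu k * sraS nu l = sraR nu (k - l).
Proof. by rewrite -sra_piM; exact/sra_pi_rel/sra_RS. Qed.

Lemma sraSR (k l : 'I_n) : sraS nu k * sraR nu l = sraR nu (k + l).
Proof. by rewrite -sra_piM; exact/sra_pi_rel/sra_SR. Qed.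

Lemma sraL_a p i : sraL p * a i = - (b i * sraL (p + 1)).
Proof. by rewrite -!sra_pi_fL -!sra_piM -sra_piN; exact/sra_pi_rel/sra_La. Qed.

Lemma sraL_b p i : sraL p * b i = - (a i * sraL (p - 1)).
Proof. by rewrite -!sra_pi_fL -!sra_piM -sra_piN; exact/sra_pi_rel/sra_Lb. Qed.

Lemma sraQ_a p i :
  sra_pi nu (fQ R m p) * a i = a i * sra_pi nu (fQ R m (p + 1)).
Proof. by rewrite -!sra_piM; exact/sra_pi_rel/sra_Qa. Qed.

Lemma sraQ_b p i :
  sra_pi nu (fQ R m p) * b i = b i * sra_pi nu (fQ R m (p - 1)).
Proof. by rewrite -!sra_piM; exact/sra_pi_rel/sra_Qb. Qed.

Lemma sra_pi_commutator (x y : sra_free R m) :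
  sra_pi nu (commutator x y) = commutator (sra_pi nu x) (sra_pi nu y).
Proof. exact: etrans (sra_piB _ _) (f_equal2 _ (sra_piM _ _) (f_equal _ (sra_piM _ _))). Qed.

Lemma sra_comm_ab i j : commutator (a i) (b j) = eps R i j *: (1 + mu *: sraL 0).
Proof.
rewrite -sra_pi_commutator (sra_pi_rel (sra_ab _ _ _ _)).
by rewrite sra_piZ sra_piD sra_pi1 sra_piZ sra_pi_fL.
Qed.

Lemma sra_comm_aa i j : commutator (a i) (a j) = eps R i j *: (mu *: sraL 1).
Proof.
rewrite -sra_pi_commutator (sra_pi_rel (sra_aa _ _ _ _)).
by rewrite sra_piZ sra_piZ sra_pi_fL.
Qed.

Lemma sra_comm_bb i j :
  commutator (b i) (b j) = eps R i j *: (mu *: sraL (- 1)).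
Proof.
rewrite -sra_pi_commutator (sra_pi_rel (sra_bb _ _ _ _)).
by rewrite sra_piZ sra_piZ sra_pi_fL.
Qed.

(** The sign [e] covers both the [L_p] and the [Q_p], whose exponents are opposite. The shift [q]
    turns relations such as [L_p a = - b L_(p+1)] into phases for the single group elements. *)
Lemma fourier_inversion (V : lmodType C) (e : int) (X : 'I_n -> V)
    (k : 'I_n) (q : int) : e ^+ 2 = 1 ->
  \sum_(p < n) w ^ (- (e * (k%:Z * p))) *:
    (n%:R^-1 *: \sum_(l < n) w ^ (e * (l%:Z * (p%:Z + q))) *: X l) =
  w ^ (e * (k%:Z * q)) *: X k.
Proof.
move=> e1.
under eq_bigr => p _ do rewrite scalerA mulrC -scalerA scaler_sumr.
rewrite -scaler_sumr exchange_big/=.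
under eq_bigr => l _.
  under eq_bigr => p _.
    rewrite scalerA -expfzDr ?lambda_neq0//.
    have -> : - (e * (k%:Z * p)) + e * (l%:Z * (p%:Z + q)) =
      p%:Z * (e * (l%:Z - k%:Z)) + e * (l%:Z * q) by ring.
    rewrite expfzDr ?lambda_neq0// mulrC -scalerA; over.
  rewrite -scaler_sumr -scaler_suml sum_lambda; over.
rewrite (bigD1 k)//= subrr mulr0 dvdz0 big1 ?addr0 => [|l lk].
  by rewrite !scalerA mulrCA mulVf ?mulr1// pnatr_eq0.
case: ifPn => [|_]; last by rewrite scale0r scaler0.
have /orP[/eqP ->|/eqP ->] : (e == 1) || (e == -1) by rewrite -sqrf_eq1 e1.
all: rewrite ?mul1r ?mulN1r ?opprB -eqz_mod_dvd !modz_small ?ltz_nat ?ltn_ord//.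
all: by move/eqP=> [/val_inj kl]; rewrite kl eqxx in lk.
Qed.

Lemma sraR_fourier (k : 'I_n) (q : int) :
  w ^ (k%:Z * q) *: sraR nu k =
  \sum_(p < n) w ^ (- (k%:Z * p)) *: sraL (p%:Z + q).
Proof.
have := fourier_inversion (sraR nu) k q (expr1n _ 2).
rewrite mul1r => <-; apply: eq_bigr => p _; rewrite mul1r.
do 2 apply: f_equal; apply: eq_bigr => l _.
by rewrite mul1r.
Qed.

Lemma sraS_fourier (k : 'I_n) (q : int) :
  w ^ (- (k%:Z * q)) *: sraS nu k =
  \sum_(p < n) w ^ (k%:Z * p) *: sra_pi nu (fQ R m (p%:Z + q)).
Proof.
have := fourier_inversion (sraS nu) k q (sqrrN 1 : (-1 : int) ^+ 2 = 1).
rewrite mulN1r => <-; apply: eq_bigr => p _; rewrite mulN1r opprK sra_pi_fQ.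
do 2 apply: f_equal; apply: eq_bigr => l _.
by rewrite mulN1r.
Qed.

Lemma sraR_a (k : 'I_n) i : sraR nu k * a i = - (w ^ k%:Z *: (b i * sraR nu k)).
Proof.
have H0 := sraR_fourier k 0; have H1 := sraR_fourier k 1.
rewrite mulr0 expr0z scale1r in H0; rewrite mulr1 in H1.
rewrite sra_scalerAr H1 H0 mulr_suml mulr_sumr -sumrN; apply: eq_bigr => p _.
by rewrite -sra_scalerAl -sra_scalerAr -scalerN addr0 sraL_a.
Qed.

Lemma sraR_b (k : 'I_n) i :
  sraR nu k * b i = - (w ^ (- k%:Z) *: (a i * sraR nu k)).
Proof.
have H0 := sraR_fourier k 0; have H1 := sraR_fourier k (-1).
rewrite mulr0 expr0z scale1r in H0; rewrite mulrN1 in H1.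
rewrite sra_scalerAr H1 H0 mulr_suml mulr_sumr -sumrN; apply: eq_bigr => p _.
by rewrite -sra_scalerAl -sra_scalerAr -scalerN addr0 sraL_b.
Qed.

Lemma sraS_a (k : 'I_n) i : sraS nu k * a i = w ^ (- k%:Z) *: (a i * sraS nu k).
Proof.
have H0 := sraS_fourier k 0; have H1 := sraS_fourier k 1.
rewrite mulr0 oppr0 expr0z scale1r in H0; rewrite mulr1 in H1.
rewrite sra_scalerAr H1 H0 mulr_suml mulr_sumr; apply: eq_bigr => p _.
by rewrite -sra_scalerAl -sra_scalerAr addr0 sraQ_a.
Qed.

Lemma sraS_b (k : 'I_n) i : sraS nu k * b i = w ^ k%:Z *: (b i * sraS nu k).
Proof.
have H0 := sraS_fourier k 0; have H1 := sraS_fourier k (-1).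
rewrite mulr0 oppr0 expr0z scale1r in H0; rewrite mulrN1 opprK in H1.
rewrite sra_scalerAr H1 H0 mulr_suml mulr_sumr; apply: eq_bigr => p _.
by rewrite -sra_scalerAl -sra_scalerAr addr0 sraQ_b.
Qed.

Lemma sra_pi_monom (c : C) (s : seq (generator n)) :
  sra_pi nu (mkmalgU (FMonom s) c) = c *: \prod_(g <- s) sra_generator g.
Proof.
rewrite -[c in LHS]mulr1 -[mkmalgU _ _]/(mkmalgU (FMonom s) (c * 1) : sra_free R m).
have -> : mkmalgU (FMonom s) (c * 1) = c *: mkmalgU (FMonom s) 1 :> sra_free R m.
  by apply/malgP => k; rewrite mcoeffZ !mcoeffU mulrnAr.
rewrite sra_piZ; congr (_ *: _); elim: s => [|g s IHs].
  rewrite big_nil -sra_pi1; congr sra_pi.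
  by congr mkmalgU; rewrite -fmoneE.
have -> : mkmalgU (FMonom (g :: s)) 1 = letter C g * mkmalgU (FMonom s) 1.
  by rewrite malgM_def fgmulUU mulr1 /mmul/= fmmulE fmuE.
rewrite sra_piM IHs big_cons; congr (_ * _).
by case: g.
Qed.

Lemma sra_word_span (P : H -> Prop) :
  P 0 -> (forall c x y, P x -> P y -> P (c *: x + y)) ->
  (forall s : seq (generator n), P (\prod_(g <- s) sra_generator g)) ->
  forall x, P x.
Proof.
move=> P0 PD Pw x; have [y <-] : exists y, sra_pi nu y = x.
  exact: presented_pi_surj.
rewrite (monalgE y) sra_pi_sum; apply: big_rec => // -[s] z _ IH.
by rewrite sra_pi_monom; exact: PD.
Qed.

End Relations.

(** * Uniqueness of traces and supertraces *)

(* The relations of [sra], for elements of an arbitrary ring in which the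
   scalars act through a central morphism. *)
Section Uniqueness.
Context (R : realType) (m : nat) (nu : R[i]).
Local Notation C := R[i].
Local Notation n := m.*2.+1.
Local Notation w := (lambda R m).
Local Notation letter := (bool * 'I_2)%type.
Local Notation V := {ffun letter -> C}.

Definition flip (t : letter) : letter := (~~ t.1, t.2).

(** The flag [true] stands for [b]. The commutator of two letters contains [mu L_q] with [q = 1] for
    two [a], [q = -1] for two [b] and [q = 0] otherwise; this is the exponent [q l] of [lambda] in
    its coefficient of [R_l]. *)
Definition phase (e e' : bool) (l : int) : int :=
  if e == e' then if e then - l else l else 0.

Context (H : pzRingType) (iota : {rmorphism C -> H}).
Context (rR rS : 'I_n -> H) (osc : letter -> H).

Definition bracket (e e' : bool) : H :=
  iota (e != e')%:R + \sum_(l < n) iota (nu * w ^ phase e e' l%:Z) * rR l.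

Hypothesis iotaC : forall c x, iota c * x = x * iota c.
Hypothesis S0 : rS 0 = 1.
Hypothesis RR : forall k l, rR k * rR l = rS (k - l).
Hypothesis SS : forall k l, rS k * rS l = rS (k + l).
Hypothesis RS : forall k l, rR k * rS l = rR (k - l).
Hypothesis SR : forall k l, rS k * rR l = rR (k + l).
Hypothesis R_osc : forall k t, rR k * osc t =
  iota (- w ^ (if t.1 then - k%:Z else k%:Z)) * (osc (flip t) * rR k).
Hypothesis S_osc : forall k t, rS k * osc t =
  iota (w ^ (if t.1 then k%:Z else - k%:Z)) * (osc t * rS k).
Hypothesis osc_comm : forall t t', osc t * osc t' - osc t' * osc t =
  iota (eps R t.2 t'.2) * bracket t.1 t'.1.

Definition gel (g : bool * 'I_n) : H := if g.1 then rR g.2 else rS g.2.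

Definition vec (x : V) : H := \sum_t iota (x t) * osc t.

Definition word (u : seq V) : H := \prod_(x <- u) vec x.

(** Normalised so that the letters with index 0 have weight 1 and those with index 1 have weight
    -1. *)
Definition weight_op : H := iota (- 2^-1) *
  (osc (false, 0) * osc (true, 1) + osc (true, 1) * osc (false, 0) +
   (osc (true, 0) * osc (false, 1) + osc (false, 1) * osc (true, 0))).

Lemma iotaCA c x y : x * (iota c * y) = iota c * (x * y).
Proof. by rewrite mulrA -iotaC mulrA. Qed.

Lemma flipK : involutive flip.
Proof. by case=> -[]. Qed.

Lemma sum_flip (G : zmodType) (F : letter -> G) :
  \sum_t F t = \sum_t F (flip t).
Proof. exact: reindex_inj (inv_inj flipK). Qed.

Lemma sum_letters (G : zmodType) (F : letter -> G) :
  \sum_t F t = F (false, 0) + F (false, 1) + F (true, 0) + F (true, 1).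
Proof.
transitivity (\sum_t F (t.1, t.2)); first by apply: eq_bigr => -[].
rewrite -(pair_bigA _ (fun i j => F (i, j)))/= big_bool/=.
rewrite !big_ord_recl !big_ord0 !addr0 addrC !addrA.
by do !congr (_ + _); congr (F (_, _)); apply: val_inj.
Qed.

Lemma vecZD (c : C) (x y : V) : vec (c *: x + y) = iota c * vec x + vec y.
Proof.
rewrite /vec mulr_sumr -big_split; apply: eq_bigr => t _ /=.
by rewrite !ffunE rmorphD rmorphM mulrDl mulrA.
Qed.

Lemma gelM g h : exists k, gel g * gel h = gel k.
Proof.
case: g h => [[] k] [[] l]; rewrite /gel/=.
- by exists (false, k - l); rewrite RR.
- by exists (true, k - l); rewrite RS.
- by exists (true, k + l); rewrite SR.
- by exists (false, k + l); rewrite SS.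
Qed.

Lemma gel_vec g x : exists y, gel g * vec x = vec y * gel g.
Proof.
case: g => -[] k; rewrite /gel/=.
  exists [ffun t => - w ^ (if t.1 then k%:Z else - k%:Z) * x (flip t)].
  rewrite /vec mulr_sumr mulr_suml sum_flip.
  apply: eq_bigr => t _; rewrite ffunE iotaCA R_osc flipK mulrA -rmorphM mulrC.
  by case: t => -[] i; rewrite mulrA.
exists [ffun t => w ^ (if t.1 then k%:Z else - k%:Z) * x t].
rewrite /vec mulr_sumr mulr_suml; apply: eq_bigr => t _; rewrite ffunE.
by rewrite iotaCA S_osc mulrA -rmorphM mulrC mulrA.
Qed.

Lemma word_nil : word [::] = 1.
Proof. exact: big_nil. Qed.

Lemma word_cons x u : word (x :: u) = vec x * word u.
Proof. exact: big_cons. Qed.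

Lemma word_cat u v : word (u ++ v) = word u * word v.
Proof. exact: big_cat. Qed.

Lemma word_rcons u x : word (rcons u x) = word u * vec x.
Proof. by rewrite -cats1 word_cat word_cons word_nil mulr1. Qed.

Lemma gel_word g u :
  exists2 v, size v = size u & gel g * word u = word v * gel g.
Proof.
elim: u => [|x u [v vu IH]].
  by exists [::]; rewrite // word_nil mulr1 mul1r.
have [y E] := gel_vec g x; exists (y :: v); first by rewrite /= vu.
by rewrite !word_cons mulrA E -mulrA IH mulrA.
Qed.

Lemma gel_word_gel h u g :
  exists v k, gel h * (word u * gel g) = word v * gel k.
Proof.
have [v _ E] := gel_word h u; have [k E'] := gelM h g.
by exists v, k; rewrite mulrA E -mulrA E'.
Qed.

Definition unit_letter (t : letter) : V := [ffun t' => (t' == t)%:R].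

Lemma vec_unit t : vec (unit_letter t) = osc t.
Proof.
rewrite /vec (bigD1 t)//= ffunE eqxx rmorph1 mul1r big1 ?addr0// => t' tt.
by rewrite ffunE (negPf tt) rmorph0 mul0r.
Qed.

Lemma osc_word t u x : osc t * (word u * x) = word (unit_letter t :: u) * x.
Proof. by rewrite word_cons vec_unit mulrA. Qed.

(** This is the symplectic form on the span of the letters; [form_coef _ _ l] is the degenerate form
    attached to the reflection [R_l]. *)
Definition form_const (x y : V) : C :=
  \sum_t \sum_t' x t * y t' * (eps R t.2 t'.2 * (t.1 != t'.1)%:R).

Definition form_coef (x y : V) (l : 'I_n) : C :=
  \sum_t \sum_t' x t * y t' *
    (eps R t.2 t'.2 * (nu * w ^ phase t.1 t'.1 l%:Z)).

Lemma vec_comm x y : vec x * vec y - vec y * vec x =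
  iota (form_const x y) + \sum_l iota (form_coef x y l) * rR l.
Proof.
have -> : vec x * vec y - vec y * vec x =
    \sum_t \sum_t' iota (x t * y t') * (osc t * osc t' - osc t' * osc t).
  rewrite /vec !big_distrlr/= [X in _ - X]exchange_big -sumrB.
  apply: eq_bigr => t _; rewrite -sumrB; apply: eq_bigr => t' _.
  rewrite mulrBr rmorphM; congr (_ - _); first by rewrite iotaCA -!mulrA iotaCA.
  by rewrite -rmorphM mulrC rmorphM -!mulrA iotaCA.
have iota_sum2 (F : letter -> letter -> C) z :
    iota (\sum_t \sum_t' F t t') * z = \sum_t \sum_t' iota (F t t') * z.
  rewrite rmorph_sum mulr_suml; apply: eq_bigr => t _.
  by rewrite rmorph_sum mulr_suml.
rewrite -[iota (form_const x y)]mulr1 iota_sum2.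
have -> : \sum_l iota (form_coef x y l) * rR l =
    \sum_t \sum_t' \sum_(l < n) iota (x t * y t' *
      (eps R t.2 t'.2 * (nu * w ^ phase t.1 t'.1 l%:Z))) * rR l.
  transitivity (\sum_(l < n) \sum_t \sum_t' iota (x t * y t' *
      (eps R t.2 t'.2 * (nu * w ^ phase t.1 t'.1 l%:Z))) * rR l).
    by apply: eq_bigr => l _; exact: iota_sum2.
  by rewrite exchange_big; apply: eq_bigr => t _; rewrite exchange_big.
rewrite -big_split; apply: eq_bigr => t _ /=; rewrite -big_split.
apply: eq_bigr => t' _ /=; rewrite osc_comm /bracket !mulrDr !mulr_sumr mulr1.
rewrite !rmorphM !mulrA; congr (_ + _).
by apply: eq_bigr => l _; rewrite !rmorphM !mulrA.
Qed.

(** Passing a letter, [R_l] changes the sign and exchanges [a] and [b] up to a phase, so all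
    reflection terms cancel and only the constant of the bracket survives. This makes the weights of
    the letters exact for every [nu]. *)
Lemma bracket_osc e e' i : bracket (~~ e') e * osc (e', i) =
  osc (e, i) - osc (~~ e', i) * bracket e' e.
Proof.
have -> : osc (e, i) = iota (~~ e' != e)%:R * osc (e', i) +
    osc (~~ e', i) * iota (e' != e)%:R.
  by case: e e' => [] []; rewrite /= ?rmorph1 ?rmorph0 ?mul1r ?mulr1 ?mul0r
    ?mulr0 ?addr0 ?add0r.
rewrite /bracket mulrDl mulrDr -addrA; congr (_ + _).
rewrite opprD addrA subrr sub0r mulr_suml mulr_sumr -sumrN.
apply: eq_bigr => l _.
rewrite -mulrA R_osc [in RHS]iotaCA mulrA -rmorphM mulrN rmorphN mulNr.
congr (- (iota _ * _)); rewrite -mulrA -expfzDr ?lambda_neq0//.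
by congr (_ * w ^ _); case: e e' => [] []; rewrite /phase/=; ring.
Qed.

Lemma anticomm_comm (x y z : H) : (x * y + y * x) * z - z * (x * y + y * x) =
  x * (y * z - z * y) + (x * z - z * x) * y +
  (y * (x * z - z * x) + (y * z - z * y) * x).
Proof.
rewrite mulrDl mulrDr opprD addrACA; congr (_ + _).
  by rewrite mulrBr mulrBl !mulrA addrA subrK.
by rewrite mulrBr mulrBl !mulrA addrA subrK.
Qed.

Lemma iota_half x : iota 2^-1 * (x + x) = x.
Proof.
have -> : x + x = iota 2 * x by rewrite rmorphD rmorph1 mulrDl mul1r.
by rewrite mulrA -rmorphM mulVf ?pnatr_eq0// rmorph1 mul1r.
Qed.

Lemma eps01 : eps R 0 1 = 1. Proof. by []. Qed.
Lemma eps10 : eps R 1 0 = -1. Proof. by []. Qed.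
Lemma eps00 i : eps R i i = 0. Proof. by rewrite /eps subrr. Qed.

Lemma weight_op_osc0 e :
  weight_op * osc (e, 0) - osc (e, 0) * weight_op = osc (e, 0).
Proof.
rewrite /weight_op iotaCA -mulrA -mulrBr [X in X - _]mulrDl [X in _ - X]mulrDr.
rewrite opprD addrACA.
rewrite !anticomm_comm !osc_comm/= eps00 eps10 rmorph0.
have -> : iota (-1) = -1 by rewrite rmorphN rmorph1.
rewrite !mul0r !mulr0 !addr0 !add0r !mulN1r !mulrN !mulNr.
have E1 := bracket_osc e false 0; have E2 := bracket_osc e true 0.
rewrite /= in E1 E2; rewrite E1 E2.
have -> : forall x y z : H, - y - (x - z) + (- z - (x - y)) = - (x + x).
  move=> x y z; rewrite !opprD !opprK.
  by rewrite addrACA [X in _ + X]addrACA -[- y - z]opprD [y + z]addrC addrCA addNr addr0.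
by rewrite mulrN rmorphN mulNr opprK iota_half.
Qed.

Lemma weight_op_osc1 e :
  weight_op * osc (e, 1) - osc (e, 1) * weight_op = - osc (e, 1).
Proof.
rewrite /weight_op iotaCA -mulrA -mulrBr [X in X - _]mulrDl [X in _ - X]mulrDr.
rewrite opprD addrACA.
rewrite !anticomm_comm !osc_comm/= eps00 eps01 rmorph0 (rmorph1 iota).
rewrite !mul0r !mulr0 !addr0 !add0r !mul1r.
have E1 := bracket_osc e false 1; have E2 := bracket_osc e true 1.
rewrite /= in E1 E2; rewrite E1 E2.
have -> : forall x y z : H, (x - y) + z + (x - z + y) = x + x.
  by move=> x y z; rewrite addrACA [X in X + _]addrACA -opprD [y + z]addrC subrK.
by rewrite rmorphN mulNr iota_half.
Qed.

Lemma weight_op_gel g : weight_op * gel g = gel g * weight_op.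
Proof.
rewrite /weight_op iotaCA -mulrA; congr (_ * _); rewrite mulrDr mulrDl.
have SA (k : 'I_n) e i j : rS k * (osc (e, i) * osc (~~ e, j)) =
    osc (e, i) * osc (~~ e, j) * rS k.
  rewrite mulrA S_osc -mulrA -mulrA S_osc iotaCA mulrA -rmorphM.
  rewrite -expfzDr ?lambda_neq0//.
  by case: e; rewrite /= ?subrr ?addNr expr0z rmorph1 mul1r mulrA.
have RA (k : 'I_n) e i j : rR k * (osc (e, i) * osc (~~ e, j)) =
    osc (~~ e, i) * osc (e, j) * rR k.
  rewrite mulrA R_osc -mulrA -mulrA R_osc iotaCA mulrA -rmorphM.
  rewrite mulrNN -expfzDr ?lambda_neq0// /flip/= negbK.
  by case: e; rewrite /= ?subrr ?addNr expr0z rmorph1 mul1r mulrA.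
case: g => -[] k; rewrite /gel/= !mulrDl !mulrDr.
  rewrite [in RHS](RA k false 0 1) [in RHS](RA k true 1 0).
  by rewrite [in RHS](RA k true 0 1) [in RHS](RA k false 1 0) addrC.
rewrite [in RHS](SA k false 0 1) [in RHS](SA k true 1 0).
by rewrite [in RHS](SA k true 0 1) [in RHS](SA k false 1 0).
Qed.

Context (s : C) (f : H -> C).
Hypothesis s_sign : s = 1 \/ s = -1.
Hypothesis fD : forall x y, f (x + y) = f x + f y.
Hypothesis fZ : forall c x, f (iota c * x) = c * f x.
Hypothesis f_weight : forall x, f (weight_op * x) = f (x * weight_op).
(** The length is odd because a supertrace gives the sign -1 for two odd factors, but +1 if one of
    them is even. *)
Hypothesis f_vec : forall v u g, odd (size u) ->
  f (vec v * (word u * gel g)) = s * f (word u * gel g * vec v).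
(** For [s = 1] the unit is left out, as the value of a trace at 1 is not prescribed; [f_one_word]
    at the empty word derives it. *)
Hypothesis f_rS : forall k, (k != 0) || (s != 1) -> f (rS k) = 0.

Lemma f0 : f 0 = 0.
Proof. by rewrite -[0](mul0r 0) -(rmorph0 iota) fZ mul0r. Qed.

Lemma fN x : f (- x) = - f x.
Proof. by apply/eqP; rewrite -addr_eq0 -fD addNr f0. Qed.

Lemma f_sum (I : Type) (r : seq I) (P : pred I) (F : I -> H) :
  f (\sum_(i <- r | P i) F i) = \sum_(i <- r | P i) f (F i).
Proof. exact: (big_morph _ fD f0). Qed.

Lemma s_sqr : s * s = 1.
Proof. by case: s_sign => ->; rewrite ?mulrNN mulr1. Qed.

(* By linearity in each letter, it suffices to treat the words over a set
   of letters that spans. *)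
Lemma word_ind (B : pred V) y z u :
  (forall x, exists c v1 v2, [/\ B v1, B v2 & x = c *: v1 + v2]) ->
  (forall u', size u' = size u -> all B u' -> f (y * word u' * z) = 0) ->
  f (y * word u * z) = 0.
Proof.
move=> split; elim: u y => [|x u IH] y fB; first exact: fB.
have [c [v1 [v2 [B1 B2 ->]]]] := split x.
rewrite word_cons mulrA vecZD mulrDr mulrDl mulrDl fD.
rewrite iotaCA -!mulrA fZ !mulrA !IH ?mulr0 ?addr0// => u' su' Bu'.
all: rewrite -!mulrA [vec _ * (_ * _)]mulrA -word_cons mulrA fB//= ?su' ?B1 ?B2 //.
Qed.

Lemma commutator_mul (h x y : H) :
  h * (x * y) - x * y * h = (h * x - x * h) * y + x * (h * y - y * h).
Proof. by rewrite mulrBl mulrBr !mulrA addrA subrK. Qed.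

Definition weight_vector (x : V) :=
  [forall t, (t.2 == 1) ==> (x t == 0)] || [forall t, (t.2 == 0) ==> (x t == 0)].

Lemma weight_word u g : all weight_vector u ->
  exists2 k : int, (`|k| %% 2 = size u %% 2)%N &
    weight_op * (word u * gel g) - word u * gel g * weight_op =
    iota k%:~R * (word u * gel g).
Proof.
elim: u => [_|x u IH /andP[Bx Bu]].
  by exists 0; rewrite // word_nil mul1r rmorph0 mul0r weight_op_gel subrr.
have [k Ek E] := IH Bu.
have [e e1 Ex] : exists2 e : int, e = 1 \/ e = -1 &
    weight_op * vec x - vec x * weight_op = iota e%:~R * vec x.
  have D : weight_op * vec x - vec x * weight_op =
      \sum_t iota (x t) * (weight_op * osc t - osc t * weight_op).
    rewrite /vec mulr_sumr mulr_suml -sumrB; apply: eq_bigr => t _.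
    by rewrite iotaCA -mulrA -mulrBr.
  case/orP: Bx => /forallP Bx.
    exists 1; first by left.
    rewrite D rmorph1 mul1r; apply: eq_bigr => -[t i] _.
    have [-> |] := eqVneq i 0; first by rewrite weight_op_osc0.
    case: i => -[|[|]]// Hi Hi0; have /= := Bx (t, Ordinal Hi).
    by move/eqP => ->; rewrite rmorph0 !mul0r.
  exists (-1); first by right.
  rewrite D rmorphN rmorph1 mulN1r -sumrN; apply: eq_bigr => -[t i] _.
  have [-> |] := eqVneq i 1; first by rewrite weight_op_osc1 mulrN.
  case: i => -[|[|]]// Hi Hi0; have /= := Bx (t, Ordinal Hi).
  by move/eqP => ->; rewrite rmorph0 !mul0r oppr0.
exists (e + k); first by case: e1 => -> /=; lia.
rewrite word_cons -[vec x * word u * _]mulrA commutator_mul E Ex.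
by rewrite -mulrA iotaCA -mulrDl -rmorphD -intrD.
Qed.

(** A word in weight vectors has an integer weight of the parity of its length. An odd weight is
    nonzero, and [f] vanishes on commutators with [weight_op]. *)
Lemma f_odd_word u g : odd (size u) -> f (word u * gel g) = 0.
Proof.
move=> ou; rewrite -[word u]mul1r; apply: (@word_ind weight_vector) => [x|v vu Bv].
  exists 1, [ffun t => if t.2 == 0 then x t else 0],
    [ffun t => if t.2 == 1 then x t else 0]; split.
  - apply/orP; left; apply/forallP => -[e i]; rewrite ffunE /=.
    by apply/implyP => /eqP ->.
  - apply/orP; right; apply/forallP => -[e i]; rewrite ffunE /=.
    by apply/implyP => /eqP ->.
  - apply/ffunP => -[e i]; rewrite !ffunE /= scale1r.
    by case: i => -[|[|]]// Hi; rewrite ?addr0 ?add0r.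
have [k k2 E] := weight_word g Bv; rewrite mul1r.
have : f (iota k%:~R * (word v * gel g)) = 0.
  by rewrite -E fD fN f_weight subrr.
rewrite fZ => /eqP; rewrite mulf_eq0 intr_eq0 => /orP[/eqP k0|/eqP//].
by move: k2; rewrite k0 vu !modn2 ou.
Qed.

Lemma form_constE (x y : V) : form_const x y =
  x (false, 0) * y (true, 1) - x (false, 1) * y (true, 0) +
  (x (true, 0) * y (false, 1) - x (true, 1) * y (false, 0)).
Proof.
rewrite /form_const !sum_letters/= !eps00 eps01 eps10; ring.
Qed.

Lemma form_coefE (x y : V) (l : 'I_n) : form_coef x y l = nu *
  (w ^ l%:Z * (x (false, 0) * y (false, 1) - x (false, 1) * y (false, 0)) +
   (x (false, 0) * y (true, 1) - x (false, 1) * y (true, 0)) +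
   (x (true, 0) * y (false, 1) - x (true, 1) * y (false, 0)) +
   w ^ (- l%:Z) * (x (true, 0) * y (true, 1) - x (true, 1) * y (true, 0))).
Proof.
rewrite /form_coef !sum_letters/= /phase/= !eps00 eps01 eps10 expr0z; ring.
Qed.

Lemma form_const_lin (v : V) c x y :
  form_const v (c *: x + y) = c * form_const v x + form_const v y.
Proof. by rewrite !form_constE !ffunE /GRing.scale/=; ring. Qed.

(** * The induction step in even degree *)

Section Step.
Context (d : nat) (d_even : ~~ odd d).
Hypothesis low : forall u g, (size u < d)%N -> f (word u * gel g) = 0.

Lemma f_word_mid u1 u2 h g : (size u1 + size u2 < d)%N ->
  f (word u1 * gel h * word u2 * gel g) = 0.
Proof.
move=> lt_d; have [v vs E] := gel_word h u2; have [k E'] := gelM h g.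
rewrite -[word u1 * _ * _]mulrA E mulrA -word_cat -mulrA E' low//.
by rewrite size_cat vs.
Qed.

(** The commutator of the two letters is a combination of group elements. Pushed to the right, these
    leave a word with two letters fewer, to which [low] applies. *)
Lemma f_swap u1 u2 x y g : (size u1 + size u2).+2 = d ->
  f (word (u1 ++ x :: y :: u2) * gel g) = f (word (u1 ++ y :: x :: u2) * gel g).
Proof.
move=> sd; apply/eqP; rewrite -subr_eq0 -fN -fD !word_cat !word_cons; apply/eqP.
rewrite [vec x * _]mulrA [vec y * (vec x * _)]mulrA -mulrBl -mulrBr -mulrBl.
rewrite vec_comm mulrDl mulrDr mulrDl fD iotaCA -!mulrA fZ mulrA -word_cat.
rewrite low ?mulr0 ?add0r; last by rewrite size_cat; lia.
rewrite mulr_suml mulr_sumr f_sum big1// => l _.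
rewrite -!mulrA iotaCA fZ -[rR l]/(gel (true, l)) !mulrA f_word_mid ?mulr0//.
by lia.
Qed.

Lemma f_move u0 u1 u2 x g : size (u0 ++ u1 ++ x :: u2) = d ->
  f (word (u0 ++ u1 ++ x :: u2) * gel g) = f (word (u0 ++ x :: u1 ++ u2) * gel g).
Proof.
elim: u1 u0 => [//|y u1 IH] u0 /= sd.
rewrite -cat_rcons IH; last by rewrite cat_rcons.
rewrite cat_rcons f_swap//; move: sd; rewrite !size_cat /= size_cat /=; lia.
Qed.

Lemma f_perm u0 u v g : size (u0 ++ u) = d -> perm_eq u v ->
  f (word (u0 ++ u) * gel g) = f (word (u0 ++ v) * gel g).
Proof.
elim: u u0 v => [|x u IH] u0 v sd uv.
  by move: uv; rewrite perm_sym => /perm_nilP ->.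
have /splitPr E : x \in v by rewrite -(perm_mem uv) mem_head.
case: E uv => v1 v2; rewrite perm_sym (perm_catCA v1 [:: x] v2) perm_cons => uv.
rewrite f_move; last first.
  by move: sd; rewrite !size_cat /= -(perm_size uv) size_cat /=; lia.
by rewrite -!cat_rcons; apply: IH; rewrite ?cat_rcons// perm_sym.
Qed.

(** Cycling the first letter once around, past [S_k] and the other letters, multiplies the value by
    [s * w ^ j]. This is not 1: for [s = -1] because [w ^ j] is never -1, for [s = 1] because [k] is
    nonzero modulo [n]. *)
Lemma f_eigen (k : 'I_n) (t : letter) (u : seq V) :
  (k != 0) || (s != 1) -> (size u).+1 = d ->
  f (word (unit_letter t :: u) * gel (false, k)) = 0.
Proof.
move=> ks sd; pose j := if t.1 then k%:Z else - k%:Z.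
set F := f _; have : F = s * w ^ j * F.
  rewrite /F {1}word_cons -mulrA f_vec; last by move: d_even; rewrite -sd /= negbK.
  have Sx : gel (false, k) * vec (unit_letter t) =
      iota (w ^ j) * (vec (unit_letter t) * gel (false, k)).
    by rewrite vec_unit; exact: S_osc.
  rewrite -mulrA Sx iotaCA fZ -[s * _ * _]mulrA; congr (_ * (_ * _)).
  rewrite mulrA -word_rcons -cats1.
  have ux : size ([::] ++ (u ++ [:: unit_letter t])) = d.
    by rewrite /= size_cat addn1.
  have /permPl pu := perm_catC u [:: unit_letter t].
  exact: f_perm ux pu.
rewrite -{1}[F]mul1r => /eqP; rewrite -subr_eq0 -mulrBl mulf_eq0.
case/orP => [|/eqP//]; rewrite subr_eq0 => /eqP E; exfalso.
case: s_sign => s1; rewrite s1 in E; last first.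
  by have /eqP := esym E; rewrite mulN1r eqr_oppLR (negPf (lambda_expz_neqN1 _ _ _)).
move: ks; rewrite s1 eqxx orbF => /negP; apply; apply/eqP/val_inj => /=.
have /eqP := esym E; rewrite mul1r lambda_expz_eq1 /j => nj.
have {nj} : (n %| k%:Z)%Z by case: ifP nj => // _; rewrite dvdzE abszN.
rewrite dvdzE/= => nk; apply/eqP; apply: contraTT nk; rewrite -lt0n => k0.
by rewrite gtnNdvd ?ltn_ord.
Qed.

Lemma f_rS_word (k : 'I_n) u : (k != 0) || (s != 1) -> size u = d ->
  f (word u * gel (false, k)) = 0.
Proof.
move=> ks; case: u => [|x u] su; first by rewrite word_nil mul1r f_rS.
rewrite word_cons /vec -mulrA mulr_suml f_sum big1// => t _.
rewrite -mulrA fZ mulrA -vec_unit -word_cons f_eigen ?mulr0//.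
Qed.

(* [f] vanishes on the commutator of [v] with [v' * word u * gel g], which to
   leading order is a nonzero multiple of [word u * gel g] when all letters of
   [u] other than [v'] commute with [v] to leading order. *)
Lemma f_paired_word (v v' : V) (om : V -> C) g :
  gel g * vec v = iota s * (vec v * gel g) ->
  (forall c x y, om (c *: x + y) = c * om x + om y) -> om v' != 0 ->
  (forall x u1 u2, (size u1 + size u2)%N = d ->
    f (word u1 * (vec v * vec x - vec x * vec v) * word u2 * gel g) =
    om x * f (word (u1 ++ u2) * gel g)) ->
  forall u, size u = d -> f (word u * gel g) = 0.
Proof.
move=> gv om_lin om0 om_comm u su; pose B (x : V) := (x == v') || (om x == 0).
rewrite -[word u]mul1r; apply: (@word_ind B) => [x|u' su' Bu].
  exists (om x / om v'), v', (- (om x / om v') *: v' + x); split.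
  - by rewrite /B eqxx.
  - by rewrite /B om_lin mulNr divfK// addNr eqxx orbT.
  - by rewrite addrA -scalerDl subrr scale0r add0r.
rewrite mul1r; rewrite su in su'.
have count u2 u1 : all B u2 -> (size u1 + size u2)%N = d.+1 ->
    f (word u1 * (vec v * word u2 - word u2 * vec v) * gel g) =
    (count_mem v' u2)%:R * om v' * f (word (u1 ++ rem v' u2) * gel g).
  elim: u2 u1 => [|x u2 IH] u1 /= => [_ _|/andP[Bx Bu2] s12].
    by rewrite word_nil mulr1 mul1r subrr mulr0 mul0r f0 !mul0r.
  rewrite word_cons commutator_mul mulrDr mulrDl fD !mulrA om_comm; last by lia.
  rewrite -[word u1 * vec x]word_rcons IH ?size_rcons//; last by lia.
  case: (eqVneq x v') Bx => [-> _|xv'].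
    rewrite natrD mulrDl mul1r mulrDl; congr (_ + _).
    have [v'u2|] := boolP (v' \in u2); last first.
      by rewrite -has_pred1 has_count -eqn0Ngt => /eqP ->; rewrite !mul0r.
    have s12' : size (u1 ++ u2) = d.
      by rewrite size_cat; move: s12; rewrite addnS => -[].
    by rewrite cat_rcons -(f_perm _ s12' (perm_to_rem v'u2)).
  by rewrite /B (negPf xv') /= => /eqP ->; rewrite mul0r !add0r cat_rcons.
have := count (v' :: u') [::]; rewrite /= eqxx /B eqxx -/B Bu su' => /(_ isT erefl).
(* Cycling [v] costs a factor [s] and passing [g] another one. They cancel, so the commutator has
   value 0; on the other side stands one plus the number of [v'] in [u'], which is nonzero in
   characteristic 0. *)
rewrite word_nil mul1r mulrBl fD fN -[_ * word _ * _]mulrA f_vec; last first.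
  by rewrite /= su' d_even.
rewrite -mulrA gv iotaCA fZ !mulrA s_sqr mul1r subrr => /esym/eqP.
by rewrite !mulf_eq0 (negPf om0) pnatr_eq0 addnC addn1 /= => /eqP.
Qed.

Lemma f_comm_word (v x : V) u1 u2 g : (size u1 + size u2)%N = d ->
  (forall (l : 'I_n) u, size u = d ->
     form_coef v x l * f (word u * (gel (true, l) * gel g)) = 0) ->
  f (word u1 * (vec v * vec x - vec x * vec v) * word u2 * gel g) =
  form_const v x * f (word (u1 ++ u2) * gel g).
Proof.
move=> sd H0; rewrite vec_comm mulrDr 2!mulrDl fD -iotaC.
rewrite -!mulrA fZ mulrA -word_cat -[RHS]addr0; congr (_ + _).
rewrite mulr_suml mulr_sumr f_sum big1// => l _.
rewrite -!mulrA iotaCA fZ.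
have [u us E] := gel_word (true, l) u2.
rewrite -[rR l]/(gel (true, l)) [gel _ * (word _ * _)]mulrA E -mulrA mulrA -word_cat.
by rewrite H0// size_cat us.
Qed.

(** [R_k] exchanges [a] and [b] up to phases, so both signs are eigenvalues, and [v] is an
    eigenvector for [s]. The [R_l] arising from commutators with [v] combine with [R_k] to
    [S_(l - k)], settled by [f_rS_word]. In the exceptional case [l = k], [s = 1] the coefficient is
    0, because the form of [R_k] annihilates vectors fixed by [R_k]. *)
Lemma f_rR_word (k : 'I_n) u : size u = d -> f (word u * gel (true, k)) = 0.
Proof.
pose v : V := - (s * w ^ k%:Z) *: unit_letter (true, 0) + unit_letter (false, 0).
apply: (@f_paired_word v (unit_letter (false, 1)) (form_const v)).
- rewrite vecZD !vec_unit /gel/= mulrDr mulrDl iotaCA !R_osc/= /flip/= mulrDr.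
  rewrite !mulrA -!rmorphM mulrNN mulrN mulrA s_sqr mul1r addrC -mulrA.
  by rewrite -[s * _ * _]mulrA -expfzDr ?lambda_neq0// subrr expr0z mulr1.
- exact: form_const_lin.
- rewrite form_constE !ffunE/= /GRing.scale/=.
  rewrite [X in X != 0](_ : _ = - (s * w ^ k%:Z)); last by ring.
  rewrite oppr_eq0 mulf_neq0//.
    by case: s_sign => ->; rewrite ?oppr_eq0 oner_eq0.
  by rewrite expfz_neq0 ?lambda_neq0.
move=> x u1 u2 sd; apply: f_comm_word => // l v0 sv0.
rewrite /gel/= RR -[rS _]/(gel (false, l - k)).
have [lk|lk] := boolP ((l - k != 0) || (s != 1)).
  by rewrite f_rS_word ?mulr0.
move: lk; rewrite negb_or !negbK subr_eq0 => /andP[/eqP -> /eqP s1].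
have wk : w ^ (- k%:Z) * w ^ k%:Z = 1.
  by rewrite -expfzDr ?lambda_neq0// addNr expr0z.
suff -> : form_coef v x k = nu * x (true, 1) * (1 - w ^ (- k%:Z) * w ^ k%:Z).
  by rewrite wk subrr mulr0 mul0r.
by rewrite form_coefE !ffunE/= /GRing.scale/= s1; ring.
Qed.

(** Every letter commutes with the unit, so any symplectic pair serves. The reflection terms have
    the same length [d] and vanish by [f_rR_word], which therefore has to come first. *)
Lemma f_one_word u : s = 1 -> size u = d -> f (word u * gel (false, 0)) = 0.
Proof.
move=> s1; apply: (@f_paired_word (unit_letter (false, 0))
  (unit_letter (true, 1)) (form_const (unit_letter (false, 0)))).
- by rewrite /gel/= S0 mul1r mulr1 s1 rmorph1 mul1r.
- exact: form_const_lin.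
- by rewrite form_constE !ffunE/= !(mulr0, mul0r, addr0, subr0) mulr1 oner_eq0.
move=> x u1 u2 sd; apply: f_comm_word => // l v0 sv0.
by rewrite /gel/= S0 mulr1 -[rR l]/(gel (true, l)) f_rR_word ?mulr0.
Qed.

Lemma f_word_step u g : size u = d -> f (word u * gel g) = 0.
Proof.
move=> su; case: g => -[] k; first exact: f_rR_word.
have [|] := boolP ((k != 0) || (s != 1)); first exact: (fun ks => f_rS_word ks su).
by rewrite negb_or !negbK => /andP[/eqP -> /eqP s1]; exact: f_one_word.
Qed.

End Step.

Theorem f_word u g : f (word u * gel g) = 0.
Proof.
have [d] := ubnP (size u); elim: d u g => // d IH u g; rewrite ltnS => ud.
have [ou|eu] := boolP (odd (size u)); first exact: f_odd_word.
by apply: (f_word_step eu) => // u' g' lt_u; apply: IH; exact: leq_trans ud.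
Qed.

End Uniqueness.

(** * The representation of dimension r^2 *)

Section Operators.
Context (R : realType) (m r : nat) (theta mu : R[i]).
Local Notation C := R[i].
Local Notation n := m.*2.+1.
Local Notation w := (lambda R m).
Local Notation W := (int -> int -> C).
Implicit Types (phi : W) (i p q : int).

Hypothesis m_gt0 : (0 < m)%N.
Hypothesis r_ndvd : ~~ (n%:Z %| r%:Z)%Z.
Hypothesis theta_sqr : theta * theta = 1.
Hypothesis mu_theta : mu * theta = - r%:R.

Definition sgp p : C := (-1) ^ p.

(* The coupling of the labels [p] and [-p], which [L_0] exchanges when [n]
   divides [p].  The junk value at [|p| = r] does not occur, as [n] does not
   divide [r]. *)
Definition mix p : C :=
  if (n %| p)%Z then - r%:R * sgp p / (r%:R - `|p|%:~R) else 0.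

(** For fixed [p] the level runs through [r - |p|] values; this counts the ones above [i]. *)
Definition codeg i p : C := r%:R - 1 - `|p|%:~R - i%:~R.

(* The factors [i] and [codeg i p] vanish where [op_a0] and [op_a1] would leave
   the set [0 <= i], [i + |p| < r]. *)
Definition op_a0 phi : W := fun i p =>
  if 0 <= p then i%:~R * (phi (i - 1) (p + 1) + mix (p + 1) * phi (i - 1) (- p - 1))
  else phi i (p + 1) - i%:~R * mix p * phi (i - 1) (1 - p).

Definition op_a1 phi : W := fun i p =>
  if 0 <= p then codeg i p * (phi i (p + 1) + mix (p + 1) * phi i (- p - 1))
  else - phi (i + 1) (p + 1) - codeg i p * mix p * phi i (1 - p).

(** Up to the factor [theta * sgp p] this is [R_0], conjugation by which exchanges [a] and [b];
    hence the form of [op_b0] and [op_b1]. *)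
Definition mirror phi : W := fun i p => phi i (- p).

Definition op_b0 phi : W := mirror (op_a0 (mirror phi)).
Definition op_b1 phi : W := mirror (op_a1 (mirror phi)).

Definition op_L q phi : W := fun i p =>
  if (n %| p + q)%Z then theta * sgp p * phi i (- p) else 0.

Lemma sgpN p : sgp (- p) = sgp p.
Proof. by rewrite /sgp -exprz_inv invrN1. Qed.

Lemma sgpS p : sgp (p + 1) = - sgp p.
Proof. by rewrite /sgp expfzDr ?oppr_eq0 ?oner_eq0// expr1z mulrN1. Qed.

Lemma mixN p : mix (- p) = mix p.
Proof. by rewrite /mix dvdzE abszN -dvdzE sgpN normrN. Qed.

Lemma mix_mul p : (r%:R - `|p|%:~R) * mix p =
  if (n %| p)%Z then - r%:R * sgp p else 0.
Proof.
rewrite /mix; case: ifP => [np|_]; last by rewrite mulr0.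
rewrite mulrC divfK// subr_eq0; apply: contraNneq r_ndvd => rp.
move: rp; rewrite -[r%:R]/((r%:Z)%:~R) => /eqP; rewrite eqr_int => /eqP rp.
by rewrite rp -abszE; rewrite dvdzE in np; rewrite dvdzE.
Qed.

Lemma mix1 : mix 1 = 0.
Proof. by rewrite /mix ifF// dvdzE/= dvdn1; lia. Qed.

Lemma mix2 : mix 2 = 0.
Proof.
rewrite /mix ifF//; apply/negP; rewrite dvdzE/= => /dvdn_leq; lia.
Qed.

Lemma mix0 : mix 0 = -1.
Proof.
rewrite /mix dvdz0 /sgp expr0z mulr1 normr0 subr0 mulNr mulfV// pnatr_eq0.
by apply: contraNneq r_ndvd => ->; rewrite dvdz0.
Qed.

Lemma mix_mixS p a b : b = a + 1 -> mix (p + a) * mix (p + b) = 0.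
Proof.
move=> ->; rewrite addrA; set q := p + a.
rewrite /mix; case: ifP => [nq|]; last by rewrite mul0r.
rewrite ifF ?mulr0//; apply/negP => nq1.
have : (n %| (q + 1) - q)%Z by rewrite rpredB.
rewrite addrC addKr.
by rewrite dvdzE/= dvdn1; lia.
Qed.

(** As [n >= 3], consecutive labels are never both multiples of [n]. The case split feeds this to
    [ring]; [p + 0] is the shape that [norm_args] produces. *)
Lemma mix_adj p : mix (p + 1) = 0 \/ mix (p + 0) = 0 /\ mix (p + 2) = 0.
Proof.
have [->|p1] := eqVneq (mix (p + 1)) 0; [by left|right].
have /eqP := @mix_mixS p 0 1 erefl; have /eqP := @mix_mixS p 1 2 erefl.
by rewrite !mulf_eq0 (negPf p1) orbF /= => /eqP -> /eqP ->.
Qed.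

Lemma mix_adjN p :
  mix (p + - (1)) = 0 \/ mix (p + - (2)) = 0 /\ mix (p + 0) = 0.
Proof.
have [->|p1] := eqVneq (mix (p + - (1))) 0; [by left|right].
have /eqP := @mix_mixS p (- (1)) 0 erefl.
have /eqP := @mix_mixS p (- (2)) (- (1)) erefl.
by rewrite !mulf_eq0 (negPf p1) orbF /= => /eqP -> /eqP ->.
Qed.

Ltac decide_ifs := repeat match goal with
  | |- context [if 0 <= ?x then _ else _] =>
      first [have -> : (0 <= x) = true by lia | have -> : (0 <= x) = false by lia]
  end.

Ltac norm_abs := repeat match goal with
  | |- context [`|?y|] =>
      first [have -> : `|y| = y by lia | have -> : `|y| = - y by lia]
  end.

(* Writes every argument of [phi] and of [mix] as a shift of [i], [p] or
   [- p] by a numeral, so that [ring] recognizes equal values. *)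
Ltac norm_args phi i p :=
  let F := fresh "F" in let M := fresh "M" in
  pose F := phi; pose M := mix;
  repeat match goal with |- context [phi ?x ?y] =>
    let try_y a q c :=
      (have -> : phi x y = F (i + a) (q + c) by rewrite /F; congr phi; lia) in
    let try_x a := ((have _ : x = i + a by lia);
      first [try_y a p (0 : int) | try_y a p (1 : int) | try_y a p (2 : int)
            | try_y a p (-1 : int) | try_y a p (-2 : int)
            | try_y a p (3 : int) | try_y a p (-3 : int)
            | try_y a (- p) (0 : int) | try_y a (- p) (1 : int)
            | try_y a (- p) (2 : int) | try_y a (- p) (-1 : int)
            | try_y a (- p) (-2 : int)]) in
    first [try_x (0 : int) | try_x (-1 : int) | try_x (1 : int)
          | try_x (-2 : int) | try_x (2 : int)]
  end;
  repeat match goal with |- context [mix ?y] =>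
    let try_y c := (first [have -> : mix y = M (p + c)
        by rewrite /M; congr mix; lia
      | have -> : mix y = M (p + c)
        by rewrite /M; apply: etrans (esym (mixN _)) _; congr mix; lia]) in
    first [try_y (0 : int) | try_y (1 : int) | try_y (2 : int)
          | try_y (-1 : int) | try_y (-2 : int) | try_y (3 : int)]
  end;
  rewrite /M /F => {M F}.

Ltac intro_rewrite := repeat match goal with
  |- (_ = 0) -> _ => let e := fresh "e" in intro e; rewrite ?e; clear e
  end.

Ltac check_relation phi i p :=
  decide_ifs; rewrite /codeg; norm_abs; norm_args phi i p;
  rewrite ?add0r ?mix0 ?mix1 ?mix2;
  (case: (mix_adj p) => [|[]]); intro_rewrite;
  (case: (mix_adjN p) => [|[]]); intro_rewrite; ring.

Ltac split_cases p :=
  have [->|[->|[->|[?|?]]]] :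
    p = 0 \/ p = 1 \/ p = - (1) \/ 1 < p \/ p < - (1) by lia.

Lemma mu_op_L1 phi i p :
  mu * op_L 1 phi i p = (`|p + 1|%:~R - r%:R) * mix (p + 1) * phi i (- p).
Proof.
rewrite -opprB mulNr mix_mul /op_L; case: ifP => _; last first.
  by rewrite mulr0 oppr0 mul0r.
by rewrite sgpS mulrA mulrA mu_theta; ring.
Qed.

Lemma mu_op_L0 phi i p :
  mu * op_L 0 phi i p = (r%:R - `|p|%:~R) * mix p * phi i (- p).
Proof.
rewrite mix_mul /op_L addr0; case: ifP => _; last by rewrite mulr0 mul0r.
by rewrite mulrA mulrA mu_theta.
Qed.

(** The operators branch on the signs of shifted labels. The labels [0], [1], [-1] are treated
    apart; beyond them all these signs are determined. The commutators not computed here and below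
    follow by skew symmetry or by [mirror]. *)
Lemma comm_a0a1 phi i p :
  op_a0 (op_a1 phi) i p - op_a1 (op_a0 phi) i p = mu * op_L 1 phi i p.
Proof.
rewrite mu_op_L1 /op_a0 /op_a1; split_cases p.
- by check_relation phi i (0 : int).
- by check_relation phi i (0 : int).
- by check_relation phi i (0 : int).
- by check_relation phi i p.
- by check_relation phi i p.
Qed.

Lemma comm_a0b0 phi i p :
  op_a0 (op_b0 phi) i p - op_b0 (op_a0 phi) i p = 0.
Proof.
rewrite /op_b0 /mirror /op_a0; split_cases p.
- by check_relation phi i (0 : int).
- by check_relation phi i (0 : int).
- by check_relation phi i (0 : int).
- by check_relation phi i p.
- by check_relation phi i p.
Qed.

Lemma comm_a1b1 phi i p :
  op_a1 (op_b1 phi) i p - op_b1 (op_a1 phi) i p = 0.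
Proof.
rewrite /op_b1 /mirror /op_a1; split_cases p.
- by check_relation phi i (0 : int).
- by check_relation phi i (0 : int).
- by check_relation phi i (0 : int).
- by check_relation phi i p.
- by check_relation phi i p.
Qed.

Lemma comm_a0b1 phi i p :
  op_a0 (op_b1 phi) i p - op_b1 (op_a0 phi) i p = phi i p + mu * op_L 0 phi i p.
Proof.
rewrite mu_op_L0 /op_b1 /mirror /op_a0 /op_a1; split_cases p.
- by check_relation phi i (0 : int).
- by check_relation phi i (0 : int).
- by check_relation phi i (0 : int).
- by check_relation phi i p.
- by check_relation phi i p.
Qed.

(** The contributions at [- p], which come from the couplings, cancel in the sum, so the weight is
    diagonal even where [L_0] is not. *)
Lemma op_weight phi i p :
  op_a0 (op_b1 phi) i p + op_b1 (op_a0 phi) i p +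
  (op_b0 (op_a1 phi) i p + op_a1 (op_b0 phi) i p) =
  - 2 * (i%:~R - codeg i p) * phi i p.
Proof.
rewrite /op_b0 /op_b1 /mirror /op_a0 /op_a1; split_cases p.
- by check_relation phi i (0 : int).
- by check_relation phi i (0 : int).
- by check_relation phi i (0 : int).
- by check_relation phi i p.
- by check_relation phi i p.
Qed.

End Operators.

(** * Evaluation of the free algebra in matrices *)

Section FreeEvaluation.
Context (K : comNzRingType) (I : choiceType) (d : nat) (G : I -> 'M[K]_d.+1).

Definition monom_mx (s : fmonom I) : 'M[K]_d.+1 := \prod_(g <- (s : seq I)) G g.

Lemma monom_mx_is_mmorphism : mmorphism monom_mx.
Proof.
split=> [s t|]; first by rewrite /monom_mx fmM big_cat.
by rewrite /monom_mx fm1 big_nil.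
Qed.

HB.instance Definition _ :=
  isMultiplicative.Build (fmonom I) 'M[K]_d.+1 monom_mx monom_mx_is_mmorphism.

Definition eval_mx (x : malg (fmonom I) K) : 'M[K]_d.+1 :=
  mmap (@scalar_mx K d.+1) monom_mx x.

Lemma eval_mxB x y : eval_mx (x - y) = eval_mx x - eval_mx y.
Proof. exact: mmapB. Qed.

Lemma eval_mx1 : eval_mx 1 = 1.
Proof. exact: mmap1. Qed.

Lemma eval_mxM x y : eval_mx (x * y) = eval_mx x * eval_mx y.
Proof.
have comm g (k k' : fmonom I) :
    GRing.comm (@scalar_mx K d.+1 (mcoeff k g)) (monom_mx k').
  exact: esym (scalar_mxC _ _).
have := commr_mmap_is_multiplicative comm.
by case=> H _; exact: H.
Qed.

Lemma eval_mxZ c x : eval_mx (c *: x) = c *: eval_mx x.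
Proof. by rewrite -mul_scalar_mx; exact: mmapZ. Qed.

Lemma eval_mx_letter i : eval_mx (letter K i) = G i.
Proof.
by rewrite /eval_mx /letter mmapU mul1r /monom_mx fmU big_seq1.
Qed.

End FreeEvaluation.

(** * Matrices of operators on functions of two integers *)

Section OperatorMatrices.
Context (C : comNzRingType) (r' : nat).
Local Notation W := (int -> int -> C).
Local Notation B := ('I_r'.+1 * 'I_r'.+1)%type.
Local Notation d := (r'.+1 * r'.+1).-1.
Implicit Types (T U : W -> W) (phi psi : W) (i p : int).

Definition shell i p := (0 <= i) && (i + `|p| <= r').

(* Enumerates [shell] by pairs of numbers at most [r']. *)
Definition shell_point (b : B) : int * int :=
  (Num.min b.1%:Z b.2%:Z, b.1%:Z - b.2%:Z).

Lemma shell_pointP b : shell (shell_point b).1 (shell_point b).2.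
Proof.
rewrite /shell /shell_point /=; case: b => [[k k_lt] [l l_lt]] /=; lia.
Qed.

Lemma shell_point_inj : injective shell_point.
Proof.
move=> [[k k_lt] [l l_lt]] [[k' k'_lt] [l' l'_lt]] [] /= E1 E2.
have [kk ll] : k = k' /\ l = l' by lia.
by congr (_, _); apply: val_inj.
Qed.

Lemma shell_point_surj i p : shell i p -> exists b, shell_point b = (i, p).
Proof.
move=> /andP[i0 ip].
have k_lt : (absz (Num.max i (i + p))%R < r'.+1)%N by lia.
have l_lt : (absz (Num.max i (i - p))%R < r'.+1)%N by lia.
exists (Ordinal k_lt, Ordinal l_lt); rewrite /shell_point /=.
congr (_, _); lia.
Qed.

Fact card_shell : d.+1 = #|{: B}|.
Proof. by rewrite card_prod !card_ord. Qed.

Definition shell_idx (x : 'I_d.+1) : B := enum_val (cast_ord card_shell x).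

Lemma shell_idx_bij : bijective shell_idx.
Proof.
apply: (@Bijective _ _ _ (fun b => cast_ord (esym card_shell) (enum_rank b))) => x.
  by rewrite /shell_idx enum_valK cast_ordK.
by rewrite /shell_idx cast_ordKV enum_rankK.
Qed.

Definition pt (x : 'I_d.+1) : int * int := shell_point (shell_idx x).

Definition dirac_fun (z : int * int) : W := fun i p => ((i, p) == z)%:R.

Definition op_linear T := forall c phi psi,
  T (fun i p => c * phi i p + psi i p) = fun i p => c * T phi i p + T psi i p.

(** For linear [T] this says that the functions vanishing on the shell form a stable subspace, so
    that [T] acts on the quotient, of dimension [r^2]. Relations can then be checked on functions of
    two unrestricted integers. *)
Definition op_local T := forall phi psi,
  (forall i p, shell i p -> phi i p = psi i p) ->
  forall i p, shell i p -> T phi i p = T psi i p.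

Definition op_mx T : 'M[C]_d.+1 :=
  \matrix_(x, y) T (dirac_fun (pt y)) (pt x).1 (pt x).2.

Lemma op_linear_sum T (J : Type) (s : seq J) (c : J -> C) (phi : J -> W) :
  op_linear T ->
  T (fun i p => \sum_(j <- s) c j * phi j i p) =
  fun i p => \sum_(j <- s) c j * T (phi j) i p.
Proof.
move=> linT; elim: s => [|j s IH].
  have E : (fun i p : int => \sum_(j <- [::]) c j * phi j i p) =
      fun i p => -1 * 0 + 0.
    by apply/funext => i; apply/funext => p; rewrite big_nil mulr0 addr0.
  rewrite E linT; apply/funext => i; apply/funext => p.
  by rewrite big_nil mulN1r addNr.
have -> : (fun i p : int => \sum_(j0 <- j :: s) c j0 * phi j0 i p) =
    fun i p => c j * phi j i p + \sum_(j0 <- s) c j0 * phi j0 i p.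
  by apply/funext => i; apply/funext => p; rewrite big_cons.
by rewrite linT IH; apply/funext => i; apply/funext => p; rewrite big_cons.
Qed.

(** The image under [U] of a Dirac function agrees only on the shell with its expansion in Dirac
    functions; locality of the outer operator permits the replacement. *)
Lemma op_mx_mul T U : op_linear T -> op_local T ->
  op_mx T * op_mx U = op_mx (fun phi => T (U phi)).
Proof.
move=> linT locT; apply/matrixP => x z; rewrite !mxE.
under eq_bigr => y _ do rewrite !mxE mulrC.
have E := op_linear_sum (index_enum 'I_d.+1)
  (fun y => U (dirac_fun (pt z)) (pt y).1 (pt y).2) (fun y => dirac_fun (pt y)) linT.
apply: etrans (esym (congr1 (fun F : W => F (pt x).1 (pt x).2) E)) _.
apply: locT (shell_pointP _) => i p /shell_point_surj[b Eb].
have [g _ gK] := shell_idx_bij.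
have Epx : pt (g b) = (i, p) by rewrite /pt gK.
rewrite (bigD1 (g b)) // Epx /dirac_fun eqxx mulr1 big1 => [|y yb].
  exact: addr0.
case: eqP => [Ey|]; rewrite ?mulr0//; case/eqP: yb.
by apply: (bij_inj shell_idx_bij); apply: shell_point_inj; rewrite -!/(pt _) -Ey.
Qed.

Lemma op_mx_ext T U :
  (forall phi i p, T phi i p = U phi i p) -> op_mx T = op_mx U.
Proof. by move=> E; apply/matrixP => x y; rewrite !mxE E. Qed.

Lemma op_mx_lin (c : C) T U :
  op_mx (fun phi i p => c * T phi i p + U phi i p) = c *: op_mx T + op_mx U.
Proof. by apply/matrixP => x y; rewrite !mxE. Qed.

Lemma op_mxN T : op_mx (fun phi i p => - T phi i p) = - op_mx T.
Proof. by apply/matrixP => x y; rewrite !mxE. Qed.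

Lemma op_mx_diag (D : int -> int -> C) :
  op_mx (fun phi i p => D i p * phi i p) =
  diag_mx (\row_x D (pt x).1 (pt x).2).
Proof.
apply/matrixP => x y; rewrite !mxE /dirac_fun -surjective_pairing.
rewrite (inj_eq shell_point_inj) (inj_eq (bij_inj shell_idx_bij)).
by rewrite mulr_natr.
Qed.

Lemma op_mx_id : op_mx id = 1.
Proof.
apply/matrixP => x y; rewrite !mxE /dirac_fun -surjective_pairing.
by rewrite (inj_eq shell_point_inj) (inj_eq (bij_inj shell_idx_bij)).
Qed.

(** In the coordinates of [shell_point] the shell is a full square, so that the sum of [x^p] takes
    the form treated by [fejer]. *)
Lemma mxtrace_op_diag (D : int -> int -> C) :
  \tr (op_mx (fun phi i p => D i p * phi i p)) =
  \sum_(k < r'.+1) \sum_(l < r'.+1)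
    D (Num.min k%:Z l%:Z) (k%:Z - l%:Z).
Proof.
rewrite op_mx_diag mxtrace_diag.
under eq_bigr do rewrite mxE.
rewrite pair_bigA /=.
have [g gK Kg] := shell_idx_bij.
rewrite (reindex shell_idx) /=; last by exists g => ? _.
by [].
Qed.

End OperatorMatrices.

(** * The defining relations in the representation *)

Section Representation.
Context (R : realType) (m r' : nat) (nu theta : R[i]).
Local Notation C := R[i].
Local Notation n := m.*2.+1.
Local Notation w := (lambda R m).
Local Notation mu := (n%:R * nu).
Local Notation W := (int -> int -> C).
Local Notation r := r'.+1.
Local Notation a0 := (@op_a0 R m r).
Local Notation a1 := (@op_a1 R m r).
Local Notation b0 := (@op_b0 R m r).
Local Notation b1 := (@op_b1 R m r).
Local Notation "'L'" := (@op_L R m theta).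

Hypothesis m_gt0 : (0 < m)%N.
Hypothesis r_ndvd : ~~ (n%:Z %| r%:Z)%Z.
Hypothesis theta_sqr : theta * theta = 1.
Hypothesis mu_theta : mu * theta = - r%:R.

(** Letters shift [p] by one, so [sgp p] produces the minus sign in [R_k a = - lambda^k b R_k]. The
    sign [theta] drops out of all relations except the commutators, where it is absorbed by [mu]. *)
Definition op_R (k : 'I_n) (phi : W) : W := fun i p =>
  theta * sgp R p * w ^ (k%:Z * p) * phi i (- p).

Definition op_S (k : 'I_n) (phi : W) : W := fun i p => w ^ (k%:Z * p) * phi i p.

Definition op_Q (q : int) (phi : W) : W := fun i p =>
  if (n %| p - q)%Z then phi i p else 0.

Definition op_a (i : 'I_2) : W -> W := if i == 0 then a0 else a1.
Definition op_b (i : 'I_2) : W -> W := if i == 0 then b0 else b1.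

Lemma mirror_linear (T : W -> W) : op_linear T ->
  op_linear (fun phi : W => mirror (T (mirror phi))).
Proof. by move=> lin c phi psi; rewrite /mirror lin. Qed.

Lemma shellN i p : shell r' i (- p) = shell r' i p.
Proof. by rewrite /shell normrN. Qed.

Lemma mirror_local (T : W -> W) : op_local r' T ->
  op_local r' (fun phi : W => mirror (T (mirror phi))).
Proof.
move=> loc phi psi E i p ip; apply: loc; last by rewrite shellN.
by move=> j q jq; apply: E; rewrite shellN.
Qed.

Lemma op_a_linear j : op_linear (op_a j).
Proof.
move=> c phi psi; apply/funext => i; apply/funext => p.
by rewrite /op_a /op_a0 /op_a1; case: ifP => _; case: ifP => _; ring.
Qed.

Lemma op_b_linear j : op_linear (op_b j).
Proof.
have -> : op_b j = fun phi : W => mirror (op_a j (mirror phi)).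
  by rewrite /op_a /op_b; case: ifP.
exact: mirror_linear (op_a_linear j).
Qed.

Lemma op_a_local j : op_local r' (op_a j).
Proof.
move=> phi psi E i p /andP[i0 ip]; rewrite /op_a; case: ifP => _.
  have [->|i1] := eqVneq i 0; last first.
    by rewrite /op_a0; case: ifP => p0; rewrite !E//= /shell; lia.
  rewrite /op_a0; case: ifP => p0; first by rewrite !mul0r.
  by rewrite !mul0r !subr0 E// /shell; lia.
have [ipr|ipr] := eqVneq (i + `|p|) r'.
  have c0 : codeg R r i p = 0.
    rewrite /codeg -natr1 addrK -addrA -opprD addrC -intrD.
    by rewrite [`|p| + i]addrC ipr addNr.
  rewrite /op_a1 c0; case: ifP => p0; first by rewrite !mul0r.
  by rewrite !mul0r !subr0 E// /shell; lia.
by rewrite /op_a1; case: ifP => p0; rewrite !E//= /shell; lia.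
Qed.

Lemma op_b_local j : op_local r' (op_b j).
Proof.
have -> : op_b j = fun phi : W => mirror (op_a j (mirror phi)).
  by rewrite /op_a /op_b; case: ifP.
exact: mirror_local (op_a_local j).
Qed.

Lemma op_R_linear k : op_linear (op_R k).
Proof.
by move=> c phi psi; apply/funext => i; apply/funext => p; rewrite /op_R; ring.
Qed.

Lemma op_R_local k : op_local r' (op_R k).
Proof. by move=> phi psi E i p ip; rewrite /op_R E// shellN. Qed.

Lemma op_S_linear k : op_linear (op_S k).
Proof.
by move=> c phi psi; apply/funext => i; apply/funext => p; rewrite /op_S; ring.
Qed.

Lemma op_S_local k : op_local r' (op_S k).
Proof. by move=> phi psi E i p ip; rewrite /op_S E. Qed.

Lemma op_L_linear q : op_linear (L q).
Proof.
move=> c phi psi; apply/funext => i; apply/funext => p; rewrite /op_L.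
by case: ifP => _; ring.
Qed.

Lemma op_L_local q : op_local r' (L q).
Proof. by move=> phi psi E i p ip; rewrite /op_L E// shellN. Qed.

Lemma op_Q_linear q : op_linear (op_Q q).
Proof.
move=> c phi psi; apply/funext => i; apply/funext => p; rewrite /op_Q.
by case: ifP => _; ring.
Qed.

Lemma op_Q_local q : op_local r' (op_Q q).
Proof. by move=> phi psi E i p ip; rewrite /op_Q E. Qed.

Lemma op_b_mirror j phi i p : op_b j phi i p = op_a j (mirror phi) i (- p).
Proof. by rewrite /op_a /op_b; case: ifP. Qed.

(** Reflected labels enter [op_a] with a factor [mix], hence only at multiples of [n]. A multiplier
    symmetric there passes through [op_a] as through a plain shift of the label. *)
Lemma op_a_mul (chi : int -> C) j phi i p :
  (forall q, (n %| q)%Z -> chi (- q) = chi q) ->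
  (forall q, (n %| q)%Z -> chi (1 - q) = chi (q + 1)) ->
  op_a j (fun i q => chi q * phi i q) i p = chi (p + 1) * op_a j phi i p.
Proof.
move=> chiN chi1.
have E1 c : mix R m r (p + 1) * (chi (- p - 1) * c) =
    chi (p + 1) * (mix R m r (p + 1) * c).
  have -> : - p - 1 = - (p + 1) by ring.
  rewrite /mix; case: ifP => np; last by rewrite !mul0r mulr0.
  by rewrite chiN//; ring.
have E2 c : mix R m r p * (chi (1 - p) * c) = chi (p + 1) * (mix R m r p * c).
  rewrite /mix; case: ifP => np; last by rewrite !mul0r mulr0.
  by rewrite chi1//; ring.
rewrite /op_a /op_a0 /op_a1; case: ifP => _; case: ifP => _.
- by rewrite E1; ring.
- by rewrite -!mulrA E2; ring.
- by rewrite E1; ring.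
- by rewrite -!mulrA E2; ring.
Qed.

Lemma dvdz_add2 (t x : int) :
  (n %| t)%Z -> (n %| x + t * 2)%Z = (n %| x)%Z.
Proof. by move=> nt; rewrite [LHS]rpredDr// dvdz_mulr. Qed.

(** [L q] is a multiplier composed with [mirror], and [mirror] exchanges [op_a] and [op_b], so
    [op_a_mul] is enough; the minus sign is that of [sgpS]. *)
Lemma op_La q j phi i p : L q (op_a j phi) i p = - op_b j (L (q + 1) phi) i p.
Proof.
pose chi t : C := if (n %| - t + (q + 1))%Z then theta * sgp R t else 0.
rewrite op_b_mirror.
have -> : mirror (L (q + 1) phi) = fun i t => chi t * phi i t.
  apply/funext => i'; apply/funext => t; rewrite /mirror /op_L /chi.
  by case: ifP => _; rewrite ?mul0r// sgpN opprK.
rewrite op_a_mul.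
- rewrite /op_L /chi opprD opprK -addrA (_ : - 1 + (q + 1) = q); last by ring.
  by case: ifP => _; rewrite ?mul0r ?oppr0// sgpS sgpN; ring.
- move=> t nt; rewrite /chi sgpN opprK; congr (if _ then _ else _).
  have E : t + (q + 1) = (- t + (q + 1)) + t * 2 by ring.
  by rewrite E (dvdz_add2 _ nt).
- move=> t nt; rewrite /chi -[1 - t]opprK opprB sgpN -[t - 1]/(t + -1).
  have -> : sgp R (t - 1) = sgp R (t + 1).
    by rewrite -{2}[t](subrK 1) !sgpS opprK.
  congr (if _ then _ else _).
  have -> : - - (t - 1) + (q + 1) = (- (t + 1) + (q + 1)) + t * 2 by ring.
  by rewrite (dvdz_add2 _ nt).
Qed.

Lemma op_Lb q j phi i p : L q (op_b j phi) i p = - op_a j (L (q - 1) phi) i p.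
Proof.
pose chi t : C := if (n %| t + (q - 1))%Z then theta * sgp R t else 0.
have -> : L (q - 1) phi = fun i t => chi t * mirror phi i t.
  apply/funext => i'; apply/funext => t; rewrite /mirror /op_L /chi.
  by case: ifP => _; rewrite ?mul0r.
rewrite op_a_mul.
- rewrite /op_L op_b_mirror opprK /chi (_ : p + 1 + (q - 1) = p + q); last by ring.
  by case: ifP => _; rewrite ?mul0r ?oppr0// sgpS; ring.
- move=> t nt; rewrite /chi sgpN; congr (if _ then _ else _).
  have -> : t + (q - 1) = (- t + (q - 1)) + t * 2 by ring.
  by rewrite (dvdz_add2 _ nt).
- move=> t nt; rewrite /chi.
  have -> : sgp R (1 - t) = sgp R (t + 1).
    by rewrite addrC !sgpS sgpN.
  congr (if _ then _ else _).
  have -> : t + 1 + (q - 1) = (1 - t + (q - 1)) + t * 2 by ring.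
  by rewrite (dvdz_add2 _ nt).
Qed.

Lemma op_Qa q j phi i p : op_Q q (op_a j phi) i p = op_a j (op_Q (q + 1) phi) i p.
Proof.
pose chi t : C := if (n %| t - (q + 1))%Z then 1 else 0.
have -> : op_Q (q + 1) phi = fun i t => chi t * phi i t.
  apply/funext => i'; apply/funext => t; rewrite /op_Q /chi.
  by case: ifP => _; rewrite ?mul0r ?mul1r.
rewrite op_a_mul.
- rewrite /op_Q /chi (_ : p + 1 - (q + 1) = p - q); last by ring.
  by case: ifP => _; rewrite ?mul0r ?mul1r.
- move=> t nt; rewrite /chi; congr (if _ then _ else _).
  have -> : t - (q + 1) = (- t - (q + 1)) + t * 2 by ring.
  by rewrite (dvdz_add2 _ nt).
- move=> t nt; rewrite /chi; congr (if _ then _ else _).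
  have -> : t + 1 - (q + 1) = (1 - t - (q + 1)) + t * 2 by ring.
  by rewrite (dvdz_add2 _ nt).
Qed.

Lemma op_Qb q j phi i p : op_Q q (op_b j phi) i p = op_b j (op_Q (q - 1) phi) i p.
Proof.
pose chi t : C := if (n %| - t - (q - 1))%Z then 1 else 0.
rewrite op_b_mirror.
have -> : mirror (op_Q (q - 1) phi) = fun i t => chi t * mirror phi i t.
  apply/funext => i'; apply/funext => t; rewrite /mirror /op_Q /chi.
  by case: ifP => _; rewrite ?mul0r ?mul1r.
rewrite op_a_mul.
- rewrite /op_Q op_b_mirror /chi (_ : - (- p + 1) - (q - 1) = p - q); last by ring.
  by case: ifP => _; rewrite ?mul0r ?mul1r.
- move=> t nt; rewrite /chi opprK; congr (if _ then _ else _).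
  have -> : t - (q - 1) = (- t - (q - 1)) + t * 2 by ring.
  by rewrite (dvdz_add2 _ nt).
- move=> t nt; rewrite /chi; congr (if _ then _ else _).
  have -> : - (1 - t) - (q - 1) = (- (t + 1) - (q - 1)) + t * 2 by ring.
  by rewrite (dvdz_add2 _ nt).
Qed.

Local Notation d := (r'.+1 * r'.+1).-1.
Local Notation mx := (@op_mx C r').

Definition generator_mx (g : generator n) : 'M[C]_d.+1 :=
  match g with
  | genR k => mx (op_R k) | genS k => mx (op_S k)
  | gena i => mx (op_a i) | genb i => mx (op_b i)
  end.

Definition rho_free (x : sra_free R m) : 'M[C]_d.+1 := eval_mx generator_mx x.

Lemma rho_freeB (x y : sra_free R m) : rho_free (x - y) = rho_free x - rho_free y.
Proof. exact: eval_mxB. Qed.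

Lemma rho_freeM (x y : sra_free R m) : rho_free (x * y) = rho_free x * rho_free y.
Proof. exact: eval_mxM. Qed.

Lemma rho_freeZ c (x : sra_free R m) : rho_free (c *: x) = c *: rho_free x.
Proof. exact: eval_mxZ. Qed.

Lemma rho_free_mul2 (x y : sra_free R m) A B :
  rho_free x = A -> rho_free y = B -> rho_free (x * y) = A * B.
Proof. by move=> <- <-; exact: rho_freeM. Qed.

Lemma rho_free1 : rho_free (1 : sra_free R m) = 1.
Proof. exact: eval_mx1. Qed.

Lemma rho_free0 : rho_free (0 : sra_free R m) = 0.
Proof. by have := rho_freeB 0 0; rewrite !subrr. Qed.

Lemma rho_freeN (x : sra_free R m) : rho_free (- x) = - rho_free x.
Proof. by rewrite -[- x]sub0r rho_freeB rho_free0 sub0r. Qed.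

Lemma rho_freeD (x y : sra_free R m) : rho_free (x + y) = rho_free x + rho_free y.
Proof. by rewrite -[y in LHS]opprK rho_freeB rho_freeN opprK. Qed.

Lemma rho_free_sum (J : Type) (s : seq J) (F : J -> sra_free R m) :
  rho_free (\sum_(j <- s) F j) = \sum_(j <- s) rho_free (F j).
Proof. exact: (big_morph _ rho_freeD rho_free0). Qed.

Lemma rho_fR k : rho_free (fR R k) = mx (op_R k).
Proof. exact: eval_mx_letter. Qed.

Lemma rho_fS k : rho_free (fS R k) = mx (op_S k).
Proof. exact: eval_mx_letter. Qed.

Lemma rho_fa i : rho_free (fa R m i) = mx (op_a i).
Proof. exact: eval_mx_letter. Qed.

Lemma rho_fb i : rho_free (fb R m i) = mx (op_b i).
Proof. exact: eval_mx_letter. Qed.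

Lemma rho_fL q : rho_free (fL R m q) = mx (L q).
Proof.
rewrite /fL rho_freeZ rho_free_sum.
under eq_bigr => k _ do rewrite rho_freeZ rho_fR.
apply/matrixP => x y; rewrite !mxE summxE.
under eq_bigr => k _.
  rewrite !mxE /op_R mulrA mulrCA -expfzDr ?lambda_neq0//.
  rewrite -mulrDr [q + _]addrC; over.
rewrite -mulr_suml -mulr_sumr sum_lambda /op_L.
case: ifP => _; last by rewrite mulr0 mul0r mulr0.
by rewrite -[_ * n%:R]mulrC -!mulrA mulKf ?pnatr_eq0.
Qed.

Lemma rho_fQ q : rho_free (fQ R m q) = mx (op_Q q).
Proof.
rewrite /fQ rho_freeZ rho_free_sum.
under eq_bigr => k _ do rewrite rho_freeZ rho_fS.
apply/matrixP => x y; rewrite !mxE summxE.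
under eq_bigr => k _.
  rewrite !mxE /op_S mulrA -expfzDr ?lambda_neq0//.
  rewrite -mulrN -mulrDr [- q + _]addrC; over.
rewrite -mulr_suml sum_lambda /op_Q.
case: ifP => _; last by rewrite mul0r mulr0.
by rewrite mulrA mulVf ?pnatr_eq0// mul1r.
Qed.

Lemma rho_commutator (x y : sra_free R m) :
  rho_free (commutator x y) = rho_free x * rho_free y - rho_free y * rho_free x.
Proof.
exact: etrans (rho_freeB _ _)
  (f_equal2 _ (rho_freeM _ _) (f_equal _ (rho_freeM _ _))).
Qed.

Lemma mx_commutator (T U X : W -> W) (e : C) :
  op_linear T -> op_local r' T -> op_linear U -> op_local r' U ->
  (forall phi i p, T (U phi) i p - U (T phi) i p = e * X phi i p) ->
  mx T * mx U - mx U * mx T = e *: mx X.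
Proof.
move=> linT locT linU locU E; rewrite !op_mx_mul//.
by apply/matrixP => x y; rewrite !mxE E.
Qed.

Lemma mirrorK (phi : W) : mirror (mirror phi) = phi.
Proof. by apply/funext => i; apply/funext => p; rewrite /mirror opprK. Qed.

Lemma op_comm_ab i j phi k p :
  op_a i (op_b j phi) k p - op_b j (op_a i phi) k p =
  eps R i j * (phi k p + mu * L 0 phi k p).
Proof.
have ord2 (l : 'I_2) : l = 0 \/ l = 1.
  by case: l => -[|[|]]// Hl; [left|right]; apply: val_inj.
case: (ord2 i) => ->; case: (ord2 j) => ->; rewrite /op_a /op_b ?eqxx/=.
- by rewrite eps00 mul0r; exact: comm_a0b0.
- by rewrite eps01 mul1r; exact: comm_a0b1.
(* The case of [a1] and [b0] is the mirror image of [comm_a0b1]. *)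
- rewrite eps10 mulN1r -opprB; congr (- _).
  have := comm_a0b1 m_gt0 r_ndvd mu_theta (mirror phi) k (- p).
  have -> : b1 (mirror phi) = mirror (a1 phi) by rewrite /op_b1 mirrorK.
  have -> : b1 (a0 (mirror phi)) k (- p) = a1 (b0 phi) k p.
    by rewrite /op_b1 {1}/mirror opprK.
  move=> E; rewrite [LHS]E /mirror opprK; congr (_ + _ * _).
  by rewrite /op_L !addr0 rpredN sgpN opprK.
- by rewrite eps00 mul0r; exact: comm_a1b1.
Qed.

Lemma op_comm_aa i j phi k p :
  op_a i (op_a j phi) k p - op_a j (op_a i phi) k p =
  eps R i j * (mu * L 1 phi k p).
Proof.
have ord2 (l : 'I_2) : l = 0 \/ l = 1.
  by case: l => -[|[|]]// Hl; [left|right]; apply: val_inj.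
case: (ord2 i) => ->; case: (ord2 j) => ->; rewrite /op_a ?eqxx/=.
- by rewrite eps00 mul0r subrr.
- by rewrite eps01 mul1r; exact: comm_a0a1.
- by rewrite eps10 mulN1r -opprB; congr (- _); exact: comm_a0a1.
- by rewrite eps00 mul0r subrr.
Qed.

Lemma op_comm_bb i j phi k p :
  op_b i (op_b j phi) k p - op_b j (op_b i phi) k p =
  eps R i j * (mu * L (- 1) phi k p).
Proof.
rewrite !op_b_mirror.
have E l : mirror (op_b l phi) = op_a l (mirror phi).
  apply/funext => i'; apply/funext => p'.
  by rewrite /mirror op_b_mirror opprK.
rewrite !E op_comm_aa; congr (_ * (_ * _)).
have np : (n %| - p + 1)%Z = (n %| p + -1)%Z.
  by rewrite -[LHS]rpredN opprD opprK.
by rewrite /op_L /mirror sgpN opprK np.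
Qed.

Ltac op_side_condition := first
  [ exact: op_a_linear | exact: op_a_local | exact: op_b_linear
  | exact: op_b_local | exact: op_R_linear | exact: op_R_local
  | exact: op_S_linear | exact: op_S_local | exact: op_L_linear
  | exact: op_L_local | exact: op_Q_linear | exact: op_Q_local ].

Lemma rho_free_rel (x y : sra_free R m) : sra_rel nu x y -> rho_free x = rho_free y.
Proof.
case=> {x y}.
- rewrite rho_fS rho_free1 -(op_mx_id C r'); apply: op_mx_ext => phi i p.
  by rewrite /op_S mul0r expr0z mul1r.
- move=> k l; rewrite rho_freeM !rho_fR rho_fS op_mx_mul; try op_side_condition.
  apply: op_mx_ext => phi i p; rewrite /op_R /op_S sgpN opprK.
  rewrite lambda_expz_addI lambda_expz_oppI mulrN.
  have sg2 : sgp R p * sgp R p = 1.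
    by rewrite /sgp -expfzMl mulrNN mulr1 exp1rz.
  transitivity (theta * theta * (sgp R p * sgp R p) *
    (w ^ (k%:Z * p) * w ^ (- (l%:Z * p)) * phi i p)); first by ring.
  by rewrite theta_sqr sg2 !mul1r.
- move=> k l; rewrite rho_freeM !rho_fS op_mx_mul; try op_side_condition.
  by apply: op_mx_ext => phi i p; rewrite /op_S lambda_expz_addI mulrA.
- move=> k l; rewrite rho_freeM !rho_fR rho_fS op_mx_mul; try op_side_condition.
  apply: op_mx_ext => phi i p; rewrite /op_R /op_S.
  by rewrite lambda_expz_addI lambda_expz_oppI mulrN; ring.
- move=> k l; rewrite rho_freeM !rho_fR rho_fS op_mx_mul; try op_side_condition.
  by apply: op_mx_ext => phi i p; rewrite /op_R /op_S lambda_expz_addI; ring.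
- move=> q i; apply: etrans (rho_free_mul2 (rho_fL q) (rho_fa i)) _.
  apply/esym; apply: etrans (rho_freeN _) _.
  apply: etrans (congr1 _ (rho_free_mul2 (rho_fb i) (rho_fL (q + 1)))) _.
  rewrite !op_mx_mul; try op_side_condition.
  by rewrite -op_mxN; apply: op_mx_ext => phi k p; rewrite op_La.
- move=> q i; apply: etrans (rho_free_mul2 (rho_fL q) (rho_fb i)) _.
  apply/esym; apply: etrans (rho_freeN _) _.
  apply: etrans (congr1 _ (rho_free_mul2 (rho_fa i) (rho_fL (q - 1)))) _.
  rewrite !op_mx_mul; try op_side_condition.
  by rewrite -op_mxN; apply: op_mx_ext => phi k p; rewrite op_Lb.
- move=> q i; apply: etrans (rho_free_mul2 (rho_fQ q) (rho_fa i)) _.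
  apply/esym; apply: etrans (rho_free_mul2 (rho_fa i) (rho_fQ (q + 1))) _.
  rewrite !op_mx_mul; try op_side_condition.
  by apply: op_mx_ext => phi k p; rewrite op_Qa.
- move=> q i; apply: etrans (rho_free_mul2 (rho_fQ q) (rho_fb i)) _.
  apply/esym; apply: etrans (rho_free_mul2 (rho_fb i) (rho_fQ (q - 1))) _.
  rewrite !op_mx_mul; try op_side_condition.
  by apply: op_mx_ext => phi k p; rewrite op_Qb.
- move=> i j; rewrite rho_commutator rho_fa rho_fb rho_freeZ rho_freeD rho_free1.
  rewrite rho_freeZ rho_fL.
  have <- : mx (fun phi i p => mu * L 0 phi i p + id phi i p) =
      1 + mu *: mx (L 0) by rewrite op_mx_lin op_mx_id addrC.
  apply: mx_commutator; try op_side_condition.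
  by move=> phi k p; rewrite op_comm_ab [phi k p + _]addrC.
- move=> i j; rewrite rho_commutator !rho_fa rho_freeZ rho_freeZ rho_fL scalerA.
  apply: mx_commutator; try op_side_condition.
  by move=> phi k p; rewrite op_comm_aa mulrA.
- move=> i j; rewrite rho_commutator !rho_fb rho_freeZ rho_freeZ rho_fL scalerA.
  apply: mx_commutator; try op_side_condition.
  by move=> phi k p; rewrite op_comm_bb mulrA.
Qed.

Lemma rho_free_ideal (x : sra_free R m) : rel_ideal (sra_rel nu) x -> rho_free x = 0.
Proof.
elim=> [|y z _ Ey _ Ez|u v l s /rho_free_rel E]; first exact: rho_free0.
  by rewrite rho_freeD Ey Ez addr0.
by rewrite !rho_freeM rho_freeB E subrr mulr0 mul0r.
Qed.

(** The preimage is an arbitrary choice, which [rho_free_ideal] makes immaterial. *)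
Definition rho (x : sra m nu) : 'M[C]_d.+1 :=
  rho_free (projT1 (cid (presented_pi_surj x))).

Lemma rho_pi (x : sra_free R m) : rho (sra_pi nu x) = rho_free x.
Proof.
rewrite /rho; case: cid => y /= /eqP/presentedP/rho_free_ideal.
by rewrite rho_freeB => /eqP; rewrite subr_eq0 => /eqP.
Qed.

Lemma rhoD (x y : sra m nu) : rho (x + y) = rho x + rho y.
Proof.
have [[f <-] [g <-]] := (presented_pi_surj x, presented_pi_surj y).
have := rho_pi (f + g); rewrite sra_piD => ->.
by rewrite rho_freeD -!rho_pi.
Qed.

Lemma rhoM (x y : sra m nu) : rho (x * y) = rho x * rho y.
Proof.
have [[f <-] [g <-]] := (presented_pi_surj x, presented_pi_surj y).
have := rho_pi (f * g); rewrite sra_piM => ->.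
by rewrite rho_freeM -!rho_pi.
Qed.

Lemma rhoZ c (x : sra m nu) : rho (c *: x) = c *: rho x.
Proof.
have [f <-] := presented_pi_surj x.
have := rho_pi (c *: f); rewrite sra_piZ => ->.
by rewrite rho_freeZ -!rho_pi.
Qed.

Lemma rho1 : rho 1 = 1.
Proof. exact: etrans (rho_pi 1) rho_free1. Qed.

End Representation.

(** * Traces and supertraces through the representation *)

Section SraUniqueness.
Context (R : realType) (m : nat) (nu : R[i]).
Local Notation C := R[i].
Local Notation n := m.*2.+1.
Local Notation w := (lambda R m).
Local Notation H := (sra m nu).
Local Notation letter := (bool * 'I_2)%type.

Definition sra_const (c : C) : H := c *: (1 : H).

Lemma sra_constE c (x : H) : sra_const c * x = c *: x.
Proof. by rewrite /sra_const -sra_scalerAl mul1r. Qed.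

Lemma sra_constC c (x : H) : sra_const c * x = x * sra_const c.
Proof. by rewrite sra_constE /sra_const -sra_scalerAr mulr1. Qed.

Lemma sra_const_is_zmod_morphism : zmod_morphism sra_const.
Proof. by move=> c e; exact: scalerBl. Qed.

Lemma sra_const_is_monoid_morphism : monoid_morphism sra_const.
Proof.
split; first exact: scale1r.
by move=> c e; rewrite sra_constE /sra_const scalerA.
Qed.

HB.instance Definition _ :=
  GRing.isZmodMorphism.Build C H sra_const sra_const_is_zmod_morphism.
HB.instance Definition _ :=
  GRing.isMonoidMorphism.Build C H sra_const sra_const_is_monoid_morphism.

Definition sra_osc (t : letter) : H := if t.1 then srab m nu t.2 else sraa m nu t.2.

Local Notation word := (word (R := R) sra_const sra_osc).
Local Notation vec := (vec (R := R) sra_const sra_osc).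
Local Notation gel := (gel (sraR nu) (sraS nu)).

Definition sra_weight : H := weight_op (R := R) sra_const sra_osc.

Lemma sraR_osc (k : 'I_n) t : sraR nu k * sra_osc t =
  sra_const (- w ^ (if t.1 then - k%:Z else k%:Z)) * (sra_osc (flip t) * sraR nu k).
Proof.
rewrite sra_constE scaleNr; case: t => -[] i; rewrite /sra_osc/=.
  exact: sraR_b.
exact: sraR_a.
Qed.

Lemma sraS_osc (k : 'I_n) t : sraS nu k * sra_osc t =
  sra_const (w ^ (if t.1 then k%:Z else - k%:Z)) * (sra_osc t * sraS nu k).
Proof.
rewrite sra_constE; case: t => -[] i; rewrite /sra_osc/=.
  exact: sraS_b.
exact: sraS_a.
Qed.

Lemma mu_sraL (p : int) :
  (n%:R * nu) *: sraL m nu p = \sum_(l < n) sra_const (nu * w ^ (l%:Z * p)) * sraR nu l.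
Proof.
rewrite /sraL scalerA mulrAC mulfV ?mul1r ?pnatr_eq0// scaler_sumr.
by apply: eq_bigr => l _; rewrite scalerA sra_constE.
Qed.

Lemma sra_osc_comm t t' : sra_osc t * sra_osc t' - sra_osc t' * sra_osc t =
  sra_const (eps R t.2 t'.2) * bracket (R := R) (m := m) nu sra_const (sraR nu) t.1 t'.1.
Proof.
rewrite sra_constE /bracket; case: t t' => -[] i [[] j]; rewrite /sra_osc/= /phase/=.
- have E := sra_comm_bb m nu i j; rewrite /commutator in E; rewrite E {E}.
  rewrite mu_sraL rmorph0 add0r.
  by apply: f_equal; apply: eq_bigr => l _; rewrite mulrN1.
- have E := sra_comm_ab m nu j i; rewrite /commutator in E; rewrite -opprB E {E} -scaleNr.
  have <- : eps R i j = - eps R j i by rewrite /eps -mulrNz opprB.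
  rewrite mu_sraL rmorph1; do 2 apply: f_equal.
  by apply: eq_bigr => l _; rewrite mulr0.
- have E := sra_comm_ab m nu i j; rewrite /commutator in E; rewrite E {E}.
  rewrite mu_sraL rmorph1.
  by do 2 apply: f_equal; apply: eq_bigr => l _; rewrite mulr0.
- have E := sra_comm_aa m nu i j; rewrite /commutator in E; rewrite E {E}.
  rewrite mu_sraL rmorph0 add0r.
  by apply: f_equal; apply: eq_bigr => l _; rewrite mulr1.
Qed.

Lemma generator_word (u : seq (generator n)) :
  exists v g, \prod_(x <- u) sra_generator nu x = word v * gel g.
Proof.
elim: u => [|x u [v [g E]]].
  exists [::], (false, 0); rewrite big_nil word_nil mul1r.
  exact: esym (sraS0 m nu).
have gelP := gel_word_gel sra_constC (sraRR nu) (sraSS nu) (sraRS nu)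
  (sraSR nu) sraR_osc sraS_osc.
have oscP t : exists v' g', sra_osc t * (word v * gel g) = word v' * gel g'.
  by exists (unit_letter R t :: v), g; exact: osc_word.
rewrite big_cons E; case: x => k.
- exact: (gelP (true, k) v g).
- exact: (gelP (false, k) v g).
- exact: (oscP (false, k)).
- exact: (oscP (true, k)).
Qed.

Theorem sra_functional_eq0 (s : C) (f : H -> C) :
  s = 1 \/ s = -1 ->
  (forall x y, f (x + y) = f x + f y) ->
  (forall c x, f (c *: x) = c * f x) ->
  (forall x, f (sra_weight * x) = f (x * sra_weight)) ->
  (forall v u g, odd (size u) ->
     f (vec v * (word u * gel g)) = s * f (word u * gel g * vec v)) ->
  (forall k : 'I_n, (k != 0) || (s != 1) -> f (sraS nu k) = 0) ->
  forall x, f x = 0.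
Proof.
move=> s1 fD fZ f_weight f_vec f_S.
have fZ' c x : f (sra_const c * x) = c * f x by rewrite sra_constE fZ.
have f_w := f_word sra_constC (sraS0 m nu) (sraRR nu) (sraSS nu) (sraRS nu)
  (sraSR nu) sraR_osc sraS_osc sra_osc_comm s1 fD fZ' f_weight f_vec f_S.
apply: sra_word_span => [|c x y fx fy|u].
- by have := fZ 0 0; rewrite scale0r mul0r.
- by rewrite fD fZ fx fy mulr0 addr0.
- by have [v [g ->]] := generator_word u.
Qed.

End SraUniqueness.

(** * Parity and supertraces *)

Section Homogeneous.
Context (R : realType) (m : nat) (nu : R[i]).
Local Notation C := R[i].
Local Notation n := m.*2.+1.
Local Notation H := (sra m nu).
Local Notation hom := (@homogeneous R m nu).

Definition parity_support (e : bool) (f : sra_free R m) :=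
  forall s : fmonom (generator n), mcoeff s f != 0 ->
    odd (count (@odd_generator n) s) = e.

Lemma parity_support_monom e c (s : fmonom (generator n)) :
  (c != 0 -> odd (count (@odd_generator n) s) = e) ->
  parity_support e (mkmalgU s c).
Proof.
move=> cs k; rewrite mcoeffU; have [<-|_] := eqVneq s k; first by rewrite mulr1n.
by rewrite mulr0n eqxx.
Qed.

Lemma parity_supportD e (f g : sra_free R m) :
  parity_support e f -> parity_support e g -> parity_support e (f + g).
Proof.
move=> pf pg k; rewrite mcoeffD; have [fk|fk _] := eqVneq (mcoeff k f) 0.
  by rewrite fk add0r; exact: pg.
exact: pf.
Qed.

Lemma parity_support0 e : parity_support e (0 : sra_free R m).
Proof. by move=> k; rewrite mcoeff0 eqxx. Qed.

Lemma parity_supportZ e c (f : sra_free R m) :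
  parity_support e f -> parity_support e (c *: f).
Proof.
by move=> pf k; rewrite mcoeffZ mulf_eq0 negb_or => /andP[_]; exact: pf.
Qed.

Lemma parity_supportM e e' (f g : sra_free R m) :
  parity_support e f -> parity_support e' g ->
  parity_support (e (+) e') (f * g).
Proof.
move=> pf pg; rewrite malgME.
elim/big_ind: _ => [||k _]; first exact: parity_support0.
  by move=> x y; exact: parity_supportD.
elim/big_ind: _ => [||l _]; first exact: parity_support0.
  by move=> x y; exact: parity_supportD.
apply: parity_support_monom; rewrite mulf_eq0 negb_or => /andP[fk gl].
by rewrite fmM count_cat oddD (pf k fk) (pg l gl).
Qed.

Lemma homogeneous0 e : hom e 0.
Proof. by exists 0; [exact: parity_support0|exact: sra_pi0]. Qed.

Lemma homogeneousD e x y : hom e x -> hom e y -> hom e (x + y).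
Proof.
move=> [f pf <-] [g pg <-]; exists (f + g); first exact: parity_supportD.
exact: sra_piD.
Qed.

Lemma homogeneousZ e c x : hom e x -> hom e (c *: x).
Proof.
move=> [f pf <-]; exists (c *: f); first exact: parity_supportZ.
exact: sra_piZ.
Qed.

Lemma homogeneousM e e' x y : hom e x -> hom e' y -> hom (e (+) e') (x * y).
Proof.
move=> [f pf <-] [g pg <-]; exists (f * g); first exact: parity_supportM.
exact: sra_piM.
Qed.

Lemma homogeneous_sum e (I : Type) (s : seq I) (F : I -> H) :
  (forall i, hom e (F i)) -> hom e (\sum_(i <- s) F i).
Proof.
move=> hF; elim: s => [|i s IH]; first by rewrite big_nil; exact: homogeneous0.
by rewrite big_cons; exact: homogeneousD.
Qed.

Lemma homogeneous_generator g : hom (odd_generator g) (sra_generator nu g).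
Proof.
exists (letter C g); last by case: g.
by apply: parity_support_monom => _; rewrite fmU /=; case: odd_generator.
Qed.

Lemma homogeneous1 : hom false 1.
Proof.
exists 1; last exact: sra_pi1.
by move=> k; rewrite mcoeff1; have [->|_] := eqVneq k mone; rewrite ?fm1 ?eqxx.
Qed.

Lemma homogeneous_word (s : seq (generator n)) :
  hom (odd (count (@odd_generator n) s)) (\prod_(g <- s) sra_generator nu g).
Proof.
elim: s => [|g s IH]; first by rewrite big_nil; exact: homogeneous1.
rewrite big_cons /= oddD; apply: homogeneousM => //.
by have := homogeneous_generator g; case: odd_generator.
Qed.

Lemma homogeneous_gel g : hom false (gel (sraR nu) (sraS nu) g).
Proof.
case: g => -[] k; first exact: (homogeneous_generator (genR k)).
exact: (homogeneous_generator (genS k)).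
Qed.

Lemma homogeneous_osc t : hom true (sra_osc m nu t).
Proof.
case: t => -[] k; first exact: (homogeneous_generator (genb n k)).
exact: (homogeneous_generator (gena n k)).
Qed.

Lemma homogeneous_vec v : hom true (vec (sra_const m nu) (sra_osc m nu) v).
Proof.
apply: homogeneous_sum => t; rewrite sra_constE; apply: homogeneousZ.
exact: homogeneous_osc.
Qed.

Lemma homogeneous_oscs u :
  hom (odd (size u)) (word (sra_const m nu) (sra_osc m nu) u).
Proof.
elim: u => [|v u IH]; first by rewrite word_nil; exact: homogeneous1.
rewrite word_cons; exact: (homogeneousM (homogeneous_vec v) IH).
Qed.

Lemma homogeneous_weight : hom false (sra_weight m nu).
Proof.
rewrite /sra_weight /weight_op sra_constE; apply: homogeneousZ.
have hom2 t t' : hom false (sra_osc m nu t * sra_osc m nu t').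
  exact: (homogeneousM (homogeneous_osc t) (homogeneous_osc t')).
by do 2 apply: homogeneousD.
Qed.

Lemma supertrace_comm (t : {scalar H}) : is_supertrace t ->
  forall e e' x y, hom e x -> hom e' y -> t (x * y) = (-1) ^+ (e * e') * t (y * x).
Proof.
move=> st e e' x y hx hy; have := st e e' x y hx hy.
by rewrite linearB linearZ => /eqP; rewrite subr_eq0 => /eqP.
Qed.

(** The definition of a supertrace concerns homogeneous pairs only; words are homogeneous and span
    [H], so an even element can be cycled past any element. *)
Lemma supertrace_comm_even (t : {scalar H}) : is_supertrace t ->
  forall x y, hom false x -> t (x * y) = t (y * x).
Proof.
move=> st x y hx; move: y; apply: sra_word_span => [|c y z Ey Ez|s].
- by rewrite mulr0 mul0r.
- have L1 : t (x * (c *: y + z)) = c * t (x * y) + t (x * z).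
    by rewrite mulrDr -sra_scalerAr; exact: linearP.
  have L2 : t ((c *: y + z) * x) = c * t (y * x) + t (z * x).
    by rewrite mulrDl -sra_scalerAl; exact: linearP.
  apply: etrans L1 (etrans _ (esym L2)).
  exact: f_equal2 _ (f_equal _ Ey) Ez.
- apply: etrans (supertrace_comm st hx (homogeneous_word s)) _.
  by rewrite mul0n expr0 mul1r.
Qed.

End Homogeneous.

(** * Comparison of functionals with traces of matrices *)

Section Comparison.
Context (R : realType) (m r' : nat) (nu theta : R[i]).
Local Notation C := R[i].
Local Notation n := m.*2.+1.
Local Notation w := (lambda R m).
Local Notation mu := (n%:R * nu).
Local Notation r := r'.+1.
Local Notation d := (r'.+1 * r'.+1).-1.
Local Notation H := (sra m nu).
Local Notation mx := (@op_mx C r').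
Local Notation rho := (@rho R m r' nu theta).

Hypothesis m_gt0 : (0 < m)%N.
Hypothesis r_ndvd : ~~ (n%:Z %| r%:Z)%Z.
Hypothesis theta_sqr : theta * theta = 1.
Hypothesis mu_theta : mu * theta = - r%:R.

Lemma comp_rhoM x y : rho (x * y) = rho x * rho y.
Proof. exact: rhoM. Qed.

Lemma comp_rhoD x y : rho (x + y) = rho x + rho y.
Proof. exact: rhoD. Qed.

Lemma comp_rhoZ c x : rho (c *: x) = c *: rho x.
Proof. exact: rhoZ. Qed.

Lemma rho_mul2 x y A B : rho x = A -> rho y = B -> rho (x * y) = A * B.
Proof. by move=> <- <-; exact: comp_rhoM. Qed.

Lemma rho_add2 x y A B : rho x = A -> rho y = B -> rho (x + y) = A + B.
Proof. by move=> <- <-; exact: comp_rhoD. Qed.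

Lemma rho0 : rho 0 = 0.
Proof. by have := comp_rhoZ 0 0; rewrite !scale0r. Qed.

Lemma rho_sum (I : Type) (s : seq I) (F : I -> H) :
  rho (\sum_(i <- s) F i) = \sum_(i <- s) rho (F i).
Proof. exact: (big_morph _ comp_rhoD rho0). Qed.

Definition osc_op (t : bool * 'I_2) := if t.1 then @op_b R m r' t.2 else @op_a R m r' t.2.

Lemma rho_osc t : rho (sra_osc m nu t) = mx (osc_op t).
Proof.
by case: t => -[] i; apply: etrans (rho_pi m_gt0 r_ndvd theta_sqr mu_theta _) _;
  [exact: rho_fb|exact: rho_fa].
Qed.

Lemma rho_S k : rho (sraS nu k) = mx (op_S k).
Proof.
by apply: etrans (rho_pi m_gt0 r_ndvd theta_sqr mu_theta _) _; exact: rho_fS.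
Qed.

Lemma rho_R k : rho (sraR nu k) = mx (op_R theta k).
Proof.
by apply: etrans (rho_pi m_gt0 r_ndvd theta_sqr mu_theta _) _; exact: rho_fR.
Qed.

Lemma osc_op_linear t : op_linear (osc_op t).
Proof. by case: t => -[] i; [exact: op_b_linear|exact: op_a_linear]. Qed.

Lemma osc_op_local t : op_local r' (osc_op t).
Proof. by case: t => -[] i; [exact: op_b_local|exact: op_a_local]. Qed.

Definition diag_op (D : int -> int -> C) (phi : int -> int -> C) : int -> int -> C :=
  fun i p => D i p * phi i p.

Lemma diag_op_linear D : op_linear (diag_op D).
Proof.
by move=> c phi psi; apply/funext => i; apply/funext => p; rewrite /diag_op; ring.
Qed.

Lemma diag_op_local D : op_local r' (diag_op D).
Proof. by move=> phi psi E i p ip; rewrite /diag_op E. Qed.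

Lemma diag_mul D D' :
  mx (diag_op D) * mx (diag_op D') = mx (diag_op (fun i p => D i p * D' i p)).
Proof.
rewrite op_mx_mul; [|exact: diag_op_linear|exact: diag_op_local].
by apply: op_mx_ext => phi i p; rewrite /diag_op mulrA.
Qed.

Lemma diag_ext D D' : (forall i p, shell r' i p -> D i p = D' i p) ->
  mx (diag_op D) = mx (diag_op D').
Proof.
move=> E; rewrite !op_mx_diag; congr diag_mx; apply/rowP => x; rewrite !mxE.
by rewrite E// shell_pointP.
Qed.

Definition weight i p : C := i%:~R - codeg R r i p.

Lemma rho_weight : rho (sra_weight m nu) = mx (diag_op weight).
Proof.
rewrite /sra_weight /weight_op sra_constE comp_rhoZ.
have E2 t t' := rho_mul2 (rho_osc t) (rho_osc t').
apply: etrans (congr1 (fun A => _ *: A) (rho_add2 (rho_add2 (E2 _ _) (E2 _ _))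
  (rho_add2 (E2 _ _) (E2 _ _)))) _.
rewrite !op_mx_mul; try exact: osc_op_linear; try exact: osc_op_local.
apply/matrixP => x y; rewrite !mxE /osc_op /op_a /op_b/=.
set phi := dirac_fun _ _.
have E := op_weight m_gt0 r_ndvd phi (pt x).1 (pt x).2.
apply: etrans (congr1 (fun c => - 2^-1 * c) E) _.
by rewrite !mulrA mulrNN mulVf ?pnatr_eq0// mul1r.
Qed.

Definition parity_mx := mx (diag_op (fun _ p => sgp R p)).

Lemma sgp_sqr p : sgp R p * sgp R p = 1.
Proof. by rewrite /sgp -expfzMl mulrNN mulr1 exp1rz. Qed.

Lemma parity_sqr : parity_mx * parity_mx = 1.
Proof.
rewrite /parity_mx diag_mul -(op_mx_id C r'); apply: op_mx_ext => phi i p.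
by rewrite /diag_op sgp_sqr mul1r.
Qed.

Lemma parity_osc t :
  parity_mx * mx (osc_op t) = - (mx (osc_op t) * parity_mx).
Proof.
rewrite /parity_mx op_mx_mul; [|exact: diag_op_linear|exact: diag_op_local].
rewrite op_mx_mul; [|exact: osc_op_linear|exact: osc_op_local].
rewrite -op_mxN; apply: op_mx_ext => phi i p.
have sgp1 q : (n %| q)%Z -> sgp R (1 - q) = sgp R (q + 1).
  by move=> _; rewrite addrC !sgpS sgpN.
have sgpN' q : (n %| q)%Z -> sgp R (- q) = sgp R q by rewrite sgpN.
case: t => -[] j; rewrite /osc_op /diag_op /=.
  rewrite !op_b_mirror.
  have -> : mirror (fun i p => sgp R p * phi i p) =
      fun i p => sgp R p * mirror phi i p.
    by apply/funext => k; apply/funext => q; rewrite /mirror sgpN.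
  by rewrite op_a_mul// sgpS sgpN mulNr opprK.
by rewrite op_a_mul// sgpS mulNr opprK.
Qed.

Lemma parity_R (k : 'I_n) : parity_mx * mx (op_R theta k) = mx (op_R theta k) * parity_mx.
Proof.
rewrite /parity_mx op_mx_mul; [|exact: diag_op_linear|exact: diag_op_local].
rewrite op_mx_mul; [|exact: op_R_linear|exact: op_R_local].
by apply: op_mx_ext => phi i p; rewrite /diag_op /op_R sgpN; ring.
Qed.

Lemma interpolation (N : nat) (v : 'I_N.+1 -> C) :
  exists p : {poly C}, forall i : 'I_N.+1, p.[i%:R] = v i.
Proof.
have inj : injective (fun k : nat => k%:R : C) by move=> k l /eqP; rewrite eqr_nat => /eqP.
exists (\sum_(i < N.+1) (v i)%:P * tnth (N.+1.-lagrange (fun k => k%:R)) i) => j.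
rewrite horner_sum (bigD1 j)//= big1 => [|i ij].
  by rewrite hornerM hornerC lagrange_sample// eqxx mulr1 addr0.
by rewrite hornerM hornerC lagrange_sample// (negPf ij) mulr0.
Qed.

(* The weight separates the parities: it is the integer [2 i + |p| - r']. *)
Lemma parity_image : exists u, rho u = parity_mx.
Proof.
have poly_image (p : {poly C}) :
    exists u, rho u = mx (diag_op (fun i q => p.[weight i q])).
  elim/poly_ind: p => [|p c [u E]].
    exists 0; rewrite rho0; apply/matrixP => x y.
    by rewrite !mxE /diag_op horner0 mul0r.
  exists (u * sra_weight m nu + c *: (1 : H)).
  have E1 := etrans (comp_rhoZ c 1)
    (congr1 _ (rho1 m_gt0 r_ndvd theta_sqr mu_theta)).
  apply: etrans (rho_add2 (rho_mul2 E rho_weight) E1) _.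
  rewrite diag_mul addrC -(op_mx_id C r') -op_mx_lin.
  apply: op_mx_ext => phi i q; rewrite /diag_op hornerMXaddC; ring.
(* Shifted by [r'], the weights become [2 i + |q|]: integers from 0 to [2 r'] with the parity of
   [q]. *)
have [p Ep] := @interpolation r'.*2 (fun i => (-1) ^+ i).
have [u Eu] := poly_image (p \Po ('X + r'%:R%:P)).
exists u; rewrite Eu; apply: diag_ext => i q /andP[i0 iq].
rewrite horner_comp hornerD hornerX hornerC.
have j_lt : (absz (i *+ 2 + `|q|)%R < r'.*2.+1)%N by lia.
have -> : weight i q + r'%:R = (Ordinal j_lt)%:R.
  rewrite /weight /codeg -natr1 addrK /=.
  rewrite [RHS]pmulrn gez0_abs; last by lia.
  by rewrite rmorphD rmorphMn/=; ring.
rewrite Ep -/(sgp R q) exprnP gez0_abs; last by lia.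
rewrite expfzDr ?oppr_eq0 ?oner_eq0// -mulr_natl -exprz_exp -exprnP sqrrN expr1n.
rewrite exp1rz mul1r -/(sgp R `|q|).
by have [q0|q0] := ger0P q; rewrite ?sgpN.
Qed.

Lemma mxtrace_swap (E X Y : 'M[C]_d.+1) e :
  E * X = e *: (X * E) -> \tr (E * (X * Y)) = e * \tr (E * (Y * X)).
Proof.
move=> Ex; rewrite mulrA Ex -scalerAl mxtraceZ -mulrA.
by rewrite -mulmxE mxtrace_mulC mulmxE mulrA.
Qed.

Lemma trace_swap (E : 'M[C]_d.+1) e x y :
  E * rho x = e *: (rho x * E) ->
  \tr (E * rho (x * y)) = e * \tr (E * rho (y * x)).
Proof.
move=> Ex; have rM u v : \tr (E * rho (u * v)) = \tr (E * (rho u * rho v)).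
  exact: (congr1 (fun A => \tr (E * A)) (comp_rhoM u v)).
apply: etrans (rM x y) (etrans (mxtrace_swap (rho y) Ex) _).
exact: (congr1 (fun c => e * c) (esym (rM y x))).
Qed.

(** Meant for [E = 1], [s = 1] and for the parity matrix with [s = -1]. Since [E] commutes with the
    letters up to [s], the trace of [E * rho x] obeys the same cyclic rule as [t], and uniqueness
    applies to the difference. *)
Lemma functional_eq_trace (s c : C) (E : 'M[C]_d.+1) (t : {scalar H}) :
  s = 1 \/ s = -1 ->
  (forall t, E * mx (osc_op t) = s *: (mx (osc_op t) * E)) ->
  E * mx (diag_op weight) = mx (diag_op weight) * E ->
  E * mx (op_R theta (0 : 'I_n)) = mx (op_R theta (0 : 'I_n)) * E ->
  (forall x, t (sra_weight m nu * x) = t (x * sra_weight m nu)) ->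
  (forall x, t (sraR nu 0 * x) = t (x * sraR nu 0)) ->
  (forall v u g, odd (size u) ->
     let v' := vec (sra_const m nu) (sra_osc m nu) v in
     let u' := word (sra_const m nu) (sra_osc m nu) u * gel (sraR nu) (sraS nu) g in
     t (v' * u') = s * t (u' * v')) ->
  (forall k : 'I_n, (k <= m)%N -> (k != 0) || (s != 1) ->
     t (sraS nu k) = c * \tr (E * rho (sraS nu k))) ->
  forall x, t x = c * \tr (E * rho x).
Proof.
move=> s1 E_osc E_weight E_R t_weight t_R t_vec t_S x.
pose f x := t x - c * \tr (E * rho x).
suff : f x = 0 by move/eqP; rewrite subr_eq0 => /eqP.
have f_swap a b e : E * rho a = e *: (rho a * E) -> t (a * b) = e * t (b * a) ->
    f (a * b) = e * f (b * a).
  move=> Ea tab; rewrite mulrBr mulrCA.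
    exact: f_equal2 _ tab (congr1 (fun e' => - (c * e')) (trace_swap b Ea)).
have f_R0 y : f (sraR nu 0 * y) = f (y * sraR nu 0).
  rewrite -[RHS]mul1r; apply: f_swap; first by rewrite rho_R scale1r E_R.
  by rewrite mul1r; exact: t_R.
apply: (sra_functional_eq0 s1).
- move=> y z; rewrite /f linearD (rho_add2 (erefl (rho y)) (erefl (rho z))).
  by rewrite mulrDr mxtraceD mulrDr opprD addrACA.
- move=> e y; rewrite /f linearZ comp_rhoZ -scalerAr mxtraceZ mulrBr.
  by rewrite mulrCA.
- move=> y; rewrite -[RHS]mul1r; apply: f_swap.
    by rewrite rho_weight scale1r E_weight.
  by rewrite mul1r; exact: t_weight.
- move=> v u g su; apply: f_swap; last exact: t_vec.
  have -> : rho (vec (sra_const m nu) (sra_osc m nu) v) =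
      \sum_t0 v t0 *: mx (osc_op t0).
    rewrite /vec rho_sum; apply: eq_bigr => t0 _.
    by rewrite sra_constE comp_rhoZ rho_osc.
  rewrite mulr_sumr mulr_suml scaler_sumr; apply: eq_bigr => t0 _.
  by rewrite -scalerAr E_osc -scalerAl !scalerA mulrC.
- have f_small (k : 'I_n) : (k <= m)%N -> (k != 0) || (s != 1) -> f (sraS nu k) = 0.
    by move=> km ks; rewrite /f t_S// subrr.
  move=> k ks; have [km|mk] := leqP k m; first exact: f_small.
  (* Conjugation by [R_0] inverts [S_k], which reduces the indices above [m] to those up to [m]. *)
  have -> : f (sraS nu k) = f (sraS nu (- k)).
    have E1 : sraR nu 0 * (sraS nu k * sraR nu 0) = sraS nu (- k).
      by rewrite sraSR addr0 sraRR sub0r.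
    have E2 : sraS nu k * sraR nu 0 * sraR nu 0 = sraS nu k.
      by rewrite -mulrA sraRR subrr sraSS addr0.
    by rewrite -E1 f_R0 E2.
  apply: f_small; last by rewrite oppr_eq0.
  rewrite /= modn_small; have := ltn_ord k; lia.
Qed.

Lemma mxtrace_diag_pow (x : C) : x != 0 ->
  (2 - x - x^-1) * \tr (mx (diag_op (fun _ p => x ^ p))) = 2 - x ^+ r - x ^- r.
Proof. by move=> x0; rewrite mxtrace_op_diag; exact: fejer. Qed.

Lemma trace_S (k : 'I_n) :
  (2 - w ^ k%:Z - w ^ (- k%:Z)) * \tr (rho (sraS nu k)) =
  2 - w ^ (k%:Z * r) - w ^ (- (k%:Z * r)).
Proof.
have wk0 : w ^ k%:Z != 0 by rewrite expfz_neq0 ?lambda_neq0.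
have -> : rho (sraS nu k) = mx (diag_op (fun _ p => (w ^ k%:Z) ^ p)).
  by rewrite rho_S; apply: op_mx_ext => phi i p; rewrite /diag_op exprz_exp.
rewrite -[w ^ (- k%:Z)]invr_expz mxtrace_diag_pow// -[w ^ (- _)]invr_expz.
by rewrite -exprz_exp.
Qed.

(** Inserting the parity puts [- lambda^k] for [lambda^k] into the Fejer kernel; this turns the sine
    in the denominator into a cosine and produces the sign [(-1)^r]. *)
Lemma trace_parity_S (k : 'I_n) :
  (2 + w ^ k%:Z + w ^ (- k%:Z)) * \tr (parity_mx * rho (sraS nu k)) =
  2 - (-1) ^+ r * (w ^ (k%:Z * r) + w ^ (- (k%:Z * r))).
Proof.
have wk0 : - w ^ k%:Z != 0 by rewrite oppr_eq0 expfz_neq0 ?lambda_neq0.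
have -> : parity_mx * rho (sraS nu k) = mx (diag_op (fun _ p => (- w ^ k%:Z) ^ p)).
  rewrite rho_S [mx (op_S k)]/(mx (diag_op (fun _ p => w ^ (k%:Z * p)))) diag_mul.
  apply: op_mx_ext => phi i p.
  by rewrite /diag_op -[- _ in RHS]mulN1r expfzMl exprz_exp.
have := mxtrace_diag_pow wk0; rewrite invrN !opprK invr_expz => ->.
rewrite mulrDr opprD addrA -[w ^ (- (_ * _))]invr_expz -exprz_exp -exprnP.
rewrite -exprnP -[- w ^+ k]mulN1r exprMn invfM -[(-1) ^- r]exprVn invrN1; ring.
Qed.

Lemma mxtrace_involution (K Z : 'M[C]_d.+1) : K * K = 1 -> \tr (K * (Z * K)) = \tr Z.
Proof.
move=> KK; rewrite -[K * _]/(K *m _) mxtrace_mulC -[Z * K]/(Z *m K) -mulmxA.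
by rewrite [K *m K]KK mulmx1.
Qed.

Lemma null_trace_parity x :
  (forall y, \tr (1 * rho (x * y)) = 0) <-> (forall y, \tr (parity_mx * rho (x * y)) = 0).
Proof.
have [u Eu] := parity_image.
have rM y : rho (x * y) = rho x * rho y by exact: comp_rhoM.
have rMu y : rho (x * (y * u)) = rho x * rho y * parity_mx.
  apply: etrans (rho_mul2 (erefl _) (rho_mul2 (erefl _) Eu)) _.
  exact: mulrA.
split=> H0 y; have := H0 (y * u).
  move=> /(etrans (congr1 (fun A => \tr (1 * A)) (esym (rMu y)))) <-.
  apply: etrans (congr1 (fun A => \tr (parity_mx * A)) (rM y)) _.
  by rewrite mul1r -!mulmxE mxtrace_mulC.
move=> /(etrans (congr1 (fun A => \tr (parity_mx * A)) (esym (rMu y)))) <-.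
apply: etrans (congr1 (fun A => \tr (1 * A)) (rM y)) _.
by rewrite mul1r (mxtrace_involution _ parity_sqr).
Qed.

End Comparison.

(** * The null ideals of the trace and the supertrace *)

Theorem theorem13p1 (R : realType) (m : nat) (z : int) (nu tau tau' : R[i])
  (tr str : {scalar sra m nu}) :
  let n := m.*2.+1 in
  (1 <= m)%N ->
  ~~ (n%:Z %| z)%Z ->
  nu = z%:~R / n%:R ->
  tau != 0 -> tau' != 0 ->
  is_trace tr ->
  (forall k : 'I_m.*2.+1, (1 <= k <= m)%N ->
     tr (sraS nu k) =
       tau / (n%:R * (sin (pi * k%:R / n%:R) ^+ 2)%:C)
         * (1 - (cos (2 * pi * k%:R * z%:~R / n%:R))%:C)) ->
  is_supertrace str ->
  (forall k : 'I_m.*2.+1, (k <= m)%N ->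
     str (sraS nu k) =
       tau' / (n%:R * (cos (pi * k%:R / n%:R) ^+ 2)%:C)
         * (1 - (-1) ^ z * (cos (2 * pi * k%:R * z%:~R / n%:R))%:C)) ->
  null_ideal tr = null_ideal str.
Proof.
move=> n m_gt0 nz nuE tau0 tau'0 tr_trace tr_S str_super str_S.
have n0 : n%:R != 0 :> R[i] by rewrite pnatr_eq0.
have z0 : z != 0 by apply: contraNneq nz => ->; rewrite dvdz0.
have [r' zE] : exists r', `|z|%N = r'.+1.
  by exists (`|z|%N).-1; rewrite prednK// absz_gt0.
have r_ndvd : ~~ (n%:Z %| r'.+1%:Z)%Z
  by apply: contra nz; rewrite -zE !dvdzE.
(* As [mu = z], this sign gives [mu * theta = - |z|], so [r = |z|] serves for both signs of [z]. *)
pose theta : R[i] := if 0 < z then -1 else 1.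
have theta_sqr : theta * theta = 1 by rewrite /theta; case: ifP; rewrite ?mulrNN mulr1.
have mu_theta : n%:R * nu * theta = - r'.+1%:R.
  rewrite nuE mulrC -zE /theta [n%:R * _]mulrC divfK// pmulrn abszE.
  have [z1|z1] := ltP 0 z; first by rewrite mulN1r gtr0_norm.
  by rewrite mul1r ler0_norm// rmorphN opprK.
have cosz k : lambda R m ^ (k%:Z * r'.+1) + lambda R m ^ (- (k%:Z * r'.+1)) =
    2 * (cos (2 * pi * k%:R * z%:~R / n%:R))%:C.
  rewrite -lambda_expzD_cos -zE abszE.
  by have [|] := ger0P z; rewrite // mulrN opprK addrC.
have angle k : 2 * pi * k%:R * 1%:~R / n%:R = (pi * k%:R / n%:R) *+ 2 :> R.
  by rewrite mulr1 -[RHS]mulr_natl; ring.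
pose co k : R[i] := (cos (2 * pi * k%:R * z%:~R / n%:R))%:C.
pose sn k : R[i] := (sin (pi * k%:R / n%:R) ^+ 2)%:C.
pose cs k : R[i] := (cos (pi * k%:R / n%:R) ^+ 2)%:C.
have wS k : 2 - lambda R m ^ k%:Z - lambda R m ^ (- k%:Z) = 4 * sn k.
  have := lambda_expzD_cos R m k 1; rewrite mulr1 -addrA -opprD => ->.
  rewrite angle cos_mulr2n cos2sin2 /sn; move: (sin _ ^+ 2) => t.
  by rewrite rmorphB rmorphMn rmorphB rmorph1; ring.
have wC k : 2 + lambda R m ^ k%:Z + lambda R m ^ (- k%:Z) = 4 * cs k.
  have := lambda_expzD_cos R m k 1; rewrite mulr1 -addrA => ->.
  rewrite angle cos_mulr2n /cs; move: (cos _ ^+ 2) => t.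
  by rewrite rmorphB rmorphMn rmorph1; ring.
have sn0 (k : 'I_m.*2.+1) : k != 0 -> sn k != 0.
  move=> k0; rewrite /sn fmorph_eq0 expf_eq0/= gt_eqF// sin_gt0_pi//.
  rewrite divr_gt0 ?mulr_gt0 ?pi_gt0 ?ltr0n ?lt0n//=.
  by rewrite ltr_pdivrMr ?ltr0n// ltr_pM2l ?pi_gt0// ltr_nat.
have cs0 (k : 'I_m.*2.+1) : cs k != 0.
  have : 4 * cs k != 0; last by rewrite mulf_eq0 negb_or => /andP[].
  rewrite -wC; set x := lambda R m ^ k%:Z.
  have x0 : x != 0 by rewrite expfz_neq0 ?lambda_neq0.
  have -> : 2 + x + lambda R m ^ (- k%:Z) = (x + 1) ^+ 2 / x.
    by rewrite -invr_expz -/x; field.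
  rewrite mulf_neq0 ?invr_eq0// expf_neq0// addr_eq0; exact: lambda_expz_neqN1.
(* The matrix trace of [S_k] is [(1 - cos (2 pi k z / n)) / (2 sin^2 (pi k / n))], whence the
   constant [2 tau / n]; the supertrace is normalised likewise. *)
have tr_eq x : tr x = 2 * tau / n%:R * \tr (1 * @rho R m r' nu theta x).
  apply: (functional_eq_trace m_gt0 r_ndvd theta_sqr mu_theta (or_introl erefl)).
  - by move=> t; rewrite mul1r mulr1 scale1r.
  - by rewrite mul1r mulr1.
  - by rewrite mul1r mulr1.
  - by move=> y; apply/eqP; rewrite -subr_eq0 -linearB; apply/eqP; exact: tr_trace.
  - by move=> y; apply/eqP; rewrite -subr_eq0 -linearB; apply/eqP; exact: tr_trace.
  - move=> v u g _ v' u'; rewrite mul1r.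
    by apply/eqP; rewrite -subr_eq0 -linearB; apply/eqP; exact: tr_trace.
  move=> k km; rewrite eqxx orbF => k0; rewrite tr_S; last by rewrite km andbT lt0n.
  have := trace_S m_gt0 r_ndvd theta_sqr mu_theta k.
  rewrite wS -addrA -opprD cosz mul1r -/(sn k) -/(co k) => E.
  have {}E : \tr (rho r' theta (sraS nu k)) = (2 - 2 * co k) / (4 * sn k).
    by rewrite -E mulrC mulKf// mulf_neq0 ?pnatr_eq0 ?sn0.
  rewrite E; move: (sn0 k k0) n0; move: (sn k) (co k) (n%:R) => s c N s0 N0.
  by field; rewrite N0 s0.
have str_eq x : str x = 2 * tau' / n%:R * \tr (parity_mx R r' * @rho R m r' nu theta x).
  apply: (functional_eq_trace m_gt0 r_ndvd theta_sqr mu_theta (or_intror erefl)).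
  - by move=> t; rewrite scaleN1r parity_osc.
  - by rewrite /parity_mx !diag_mul; apply: diag_ext => i p _; rewrite mulrC.
  - exact: parity_R.
  - by move=> y; apply: supertrace_comm_even str_super _ _ (homogeneous_weight _ _).
  - move=> y; apply: supertrace_comm_even str_super _ _ _.
    exact: (homogeneous_gel nu (true, 0)).
  - move=> v u g su v' u'.
    have hu : homogeneous true u'.
      have := homogeneousM (homogeneous_oscs m nu u) (homogeneous_gel nu g).
      by rewrite su.
    exact: (supertrace_comm str_super (homogeneous_vec m nu v) hu).
  move=> k km _; rewrite str_S//.
  have := trace_parity_S m_gt0 r_ndvd theta_sqr mu_theta k.
  have sz : (-1) ^+ r'.+1 = (-1) ^ z :> R[i].
    rewrite -zE exprnP abszE -!/(sgp R _).
    by have [_|_] := ger0P z; rewrite ?sgpN.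
  rewrite wC cosz sz -/(cs k) -/(co k) => E.
  have {}E : \tr (parity_mx R r' * rho r' theta (sraS nu k)) =
      (2 - (-1) ^ z * (2 * co k)) / (4 * cs k).
    by rewrite -E mulrC mulKf// mulf_neq0 ?pnatr_eq0 ?cs0.
  rewrite E; move: (cs0 k) n0; move: (cs k) (co k) (n%:R) => s c N s0 N0.
  by field; rewrite N0 s0.
have c0 (t : R[i]) : t != 0 -> 2 * t / n%:R != 0.
  by move=> t0; rewrite mulf_neq0 ?invr_eq0 // mulf_neq0 ?pnatr_eq0.
have null_eq (t : {scalar sra m nu}) c E x : c != 0 ->
    (forall y, t y = c * \tr (E * @rho R m r' nu theta y)) ->
    (null_ideal t x <-> forall y, \tr (E * @rho R m r' nu theta (x * y)) = 0).
  move=> cN0 tE; split=> xN y; last by rewrite tE xN mulr0.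
  by have /eqP := xN y; rewrite tE mulf_eq0 (negPf cN0) => /eqP.
apply/funext => x; apply/propext.
apply: iff_trans (null_eq _ _ _ x (c0 _ tau0) tr_eq) _.
apply: iff_trans (iff_sym (null_eq _ _ _ x (c0 _ tau'0) str_eq)).
exact: null_trace_parity.
Qed.
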